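(* The open $5$-cells $UD^5=\{UP: P\in D^5\}$, for $U\in SO(3)$, are pairwise disjoint, and their union $N=\bigcup_{U\in SO(3)}UD^5$ is an open tubular neighborhood of $SO(3)$ in $S^8(\sqrt3)$, which is topologically trivial: the map $SO(3)\times D^5\to N$, $(U,P)\mapsto UP$, is a homeomorphism. Likewise, the open $5$-cells $UD^5$ for $U\in O^-(3)$ are pairwise disjoint, and their union $N'=\bigcup_{U\in O^-(3)}UD^5$ is an open tubular neighborhood of $O^-(3)$ in $S^8(\sqrt3)$, topologically trivial via $O^-(3)\times D^5\to N'$, $(U,P)\mapsto UP$. The common boundary in $S^8(\sqrt3)$ of $N$ and $N'$ is the set $V^7$ of singular matrices on $S^8(\sqrt3)$.
   Context: Real $3\times3$ matrices are identified with points of $\mathbb{R}^9$ with the Euclidean inner product $\langle A,B\rangle=\operatorname{tr}(A^TB)$, and $S^8(\sqrt3)$ is the round sphere of matrices of norm $\sqrt3$ (which contains the orthogonal group $O(3)$). $SO(3)$ and $O^-(3)$ are the components of $O(3)$ with determinant $+1$ and $-1$. $V^7=\{A\in S^8(\sqrt3):\det A=0\}$. $D^2$ is the open spherical triangle of diagonal matrices in $S^8(\sqrt3)$ with all diagonal entries positive, and $D^5=\{UAU^{-1}:A\in D^2,\ U\in SO(3)\}$, that is, the set of symmetric positive definite matrices on $S^8(\sqrt3)$; it is an open $5$-cell centered at the identity $I$, lying in the great $5$-sphere of symmetric matrices. *)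

(* Defs.v *)
From HB Require Import structures.
From mathcomp Require Import all_boot all_order all_algebra.
From mathcomp Require Import all_classical all_reals all_analysis.
Set Implicit Arguments.
Unset Strict Implicit.
Unset Printing Implicit Defensive.
Import Order.TTheory GRing.Theory Num.Theory.
Import numFieldNormedType.Exports.
Local Open Scope classical_set_scope.
Local Open Scope ring_scope.

(* The inverse of [f] on [B] is given by a total function [g], of which only  *)
(* the restriction to [B] matters.                                            *)
Definition homeomorphism (T U : topologicalType) (A : set T) (B : set U)
    (f : T -> U) : Prop :=
  [/\ set_bij A B f,
      {within A, continuous f} &
      exists g : U -> T,
        {within B, continuous g} /\ (forall x, A x -> g (f x) = x)].

Definition rel_open (T : topologicalType) (S N : set T) : Prop :=
  exists O : set T, open O /\ N = S `&` O.

Definition rel_boundary (T : topologicalType) (S N : set T) : set T :=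
  S `&` closure N `&` closure (S `\` N).

Definition open_cell (R : realType) (n : nat) (T : topologicalType)
    (C : set T) : Prop :=
  exists f : 'rV[R]_n -> T, homeomorphism setT C f.

Section Smooth.
Variables (R : realType) (V W : normedModType R).

(* In finite dimension a map is C^(k+1) on an open set iff it is              *)
(* differentiable there and all its directional derivatives are C^k.          *)
Fixpoint Ck_on (k : nat) (O : set V) (f : V -> W) : Prop :=
  match k with
  | 0%N => forall x, O x -> {for x, continuous f}
  | k'.+1 => (forall x, O x -> differentiable f x) /\
             (forall v : V, Ck_on k' O (fun x => 'D_v f x))
  end.

(* Smoothness on an arbitrary subset [A]: near each point of [A], [f] agrees  *)
(* on [A] with a C^oo map defined on an open set of the ambient space.        *)
Definition smooth_on (A : set V) (f : V -> W) : Prop :=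
  forall x, A x -> exists (O : set V) (F : V -> W),
    [/\ open O, O x, (forall k, Ck_on k O F) &
        (forall y, A y -> O y -> F y = f y)].

End Smooth.

Definition diffeomorphism (R : realType) (V W : normedModType R)
    (A : set V) (B : set W) (f : V -> W) : Prop :=
  [/\ set_bij A B f,
      smooth_on A f &
      exists g : W -> V, smooth_on B g /\ (forall x, A x -> g (f x) = x)].

Section Matrices.
Variable R : realType.
Local Notation M3 := 'M[R]_3.

(* The library's topology on ['M[R]_3] comes from the sup norm; it is the     *)
(* Euclidean topology of R^9. Lengths and angles use [mx_inner].              *)
Definition mx_inner (A B : M3) : R := \tr (A^T *m B).

Definition euclid_norm (A : M3) : R := Num.sqrt (mx_inner A A).

Definition S8 : set M3 := [set A | euclid_norm A = Num.sqrt 3].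

Definition O3 : set M3 := [set U | U^T *m U = 1%:M].
Definition SO3 : set M3 := [set U | O3 U /\ \det U = 1].
Definition Ominus3 : set M3 := [set U | O3 U /\ \det U = -1].

Definition V7 : set M3 := [set A | S8 A /\ \det A = 0].

Definition D2 : set M3 :=
  [set A | [/\ S8 A, is_diag_mx A & forall i, 0 < A i i]].

Definition D5 : set M3 :=
  [set B | exists A U, [/\ D2 A, SO3 U & B = U *m A *m invmx U]].

Definition cell (U : M3) : set M3 := [set U *m P | P in D5].

(* Velocities at [A] of the differentiable curves lying in [M].               *)
Definition tangent_space (M : set M3) (A : M3) : set M3 :=
  [set X | exists c : R -> M3,
     [/\ forall t, M (c t), c 0 = A & is_derive (0 : R) (1 : R) c X]].

(* Normal space at [A] of [M] in [S], where [M] is a submanifold of [S].      *)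
Definition normal_fiber (S M : set M3) (A : M3) : set M3 :=
  [set X | tangent_space S A X /\
           (forall Y, tangent_space M A Y -> mx_inner X Y = 0)].

Definition normal_bundle (S M : set M3) : set (M3 * M3)%type :=
  [set p | M p.1 /\ normal_fiber S M p.1 p.2].

(* [N] is an open tubular neighborhood of [M] in [S] with fibers [F A],       *)
(* [A] in [M]: an open subset of [S] with a diffeomorphism from the normal    *)
(* bundle onto it which is the identity on the zero section (identified with  *)
(* [M]), carries the normal space at [A] onto [F A], and whose derivative     *)
(* along the fibers at the zero section is the identity of the normal bundle  *)
(* (so the fibers meet [M] orthogonally).                                     *)
Definition open_tubular_neighborhood (S M N : set M3) (F : M3 -> set M3)
    : Prop :=
  rel_open S N /\
  exists f : (M3 * M3)%type -> M3,
    [/\ diffeomorphism (normal_bundle S M) N f,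
        (forall A, M A -> f (A, 0) = A),
        (forall A, M A -> [set f (A, X) | X in normal_fiber S M A] = F A) &
        (forall A X, M A -> normal_fiber S M A X ->
           is_derive (0 : R) (1 : R) (fun t : R => f (A, t *: X)) X)].

End Matrices.

Arguments S8 {R}.
Arguments O3 {R}.
Arguments SO3 {R}.
Arguments Ominus3 {R}.
Arguments V7 {R}.
Arguments D2 {R}.
Arguments D5 {R}.

(* Main.v *)
Require Import Defs.
From HB Require Import structures.
From mathcomp Require Import all_boot all_order all_algebra.
From mathcomp Require Import all_classical all_reals all_analysis.
From mathcomp Require Import ring lra.
Import Order.TTheory GRing.Theory Num.Theory.
Import numFieldNormedType.Exports.
Local Open Scope classical_set_scope.
Local Open Scope ring_scope.
Set Implicit Arguments.
Unset Strict Implicit.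
Unset Printing Implicit Defensive.

(** Every invertible matrix has a unique polar decomposition A = U P, with U
orthogonal and P the positive definite square root of A^T A. The determinant of
U is the sign of the determinant of A, and P has the same Euclidean norm as A.
So the cells UD5 over SO(3), or over O^-(3), are disjoint, and they fill exactly
the part of the sphere where the determinant is positive, or negative. Both
components are treated at once: [e] is the determinant, 1 or -1, and
[det_side e] is the open set of the sphere where e * det A > 0.

The spectral theorem [spectral_theorem] identifies D5 with the positive definite
matrices on the sphere ([D5P]) and gives existence of the square root. For
uniqueness and regularity, P^2 - Q^2 = P X + X Q with X = P - Q: the Sylvester
operator X |-> P X + X Q is invertible when P and Q are positive definite, so
that increments of the square root are the inverse Sylvester operator applied to
increments of its square. This makes the square root differentiable, and its
derivative is a rational function of the root itself, so an induction on k shows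
that it is C^k for all k ([Ck_sqrtmx]).

The normal space of the orthogonal group at U, inside the sphere, is the set of
U S with S symmetric of trace 0 ([normal_fiberP]). For such an S, the matrix
P = S + sqrt (1 + S^2) is positive definite with S = (P - P^-1) / 2, and the
trace of S vanishes iff P and P^-1 have the same trace, a condition that selects
one positive multiple of every positive definite matrix. Rescaling P to the
sphere thus identifies the symmetric matrices of trace 0 with D5
([cell_paramK], [cell_coordK]), smoothly in both directions; this gives the
5-cells, and with the polar decomposition it gives the diffeomorphism
(U, U S) |-> U [cell_param S] from the normal bundle onto [det_side e]
([tube_diffeomorphism]). Its derivative along the fibers is the identity since
[cell_param (t S)] = 1 + t S + o(t) ([is_derive_cell_param0]).

For the boundary, let A be singular, and H the reflection along a row vector in
the left kernel of A, so that H A = A. For small t > 0 such that A + t is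
nonsingular, A + t and H (A + t) are both close to A and their determinants have
opposite signs ([approach_singular]). *)

(** * Differentiability from difference quotients *)

Section Differentials.
Variables (R : realType) (V : normedModType R).

(** A map that is o(y - x) at x has differential 0 there, since 0 is a linear
approximation of it. *)
Lemma differentiable_superlinear (W : normedModType R) (e : V -> W) (x : V) :
  e x = 0 ->
  (forall eps : R, 0 < eps -> \forall y \near x, `|e y| <= eps * `|y - x|) ->
  differentiable e x /\ forall v, 'D_v e x = 0.
Proof.
move=> ex0 small.
have eo : e \o shift x = cst (e x) + (0 : V -> W) +o_ 0 id.
  apply/eqaddoP => eps eps0.
  have := small _ eps0.
  rewrite (near_shift 0 x) => H.
  near=> h; rewrite /= ex0 !fctE /= addr0 subr0.
  have Hh : (fun h => `|e (h + x)| <= eps * `|h|) h.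
    near: h; apply: filterS H => h /=.
    by rewrite subr0 addrK.
  exact: Hh.
have d0 : 'd e x = \0 :> (V -> W).
  by apply: (@diff_unique _ _ _ _ \0) => //; exact: cst_continuous.
have de : differentiable e x.
  apply/diff_locallyP; rewrite d0; split=> //; exact: cst_continuous.
by split=> // v; rewrite deriveE // d0.
Unshelve. all: by end_near. Qed.

Lemma near_eq_differentiable (W : normedModType R) (f g : V -> W) (x : V) :
  (\near x, f x = g x) -> differentiable f x -> differentiable g x.
Proof.
move=> fg df; rewrite -[g](subrK f); apply: differentiableD => //.
apply: (differentiable_superlinear _ _).1.
  by rewrite !fctE /= (nbhs_singleton fg) subrr.
move=> eps eps0; near=> y.
rewrite !fctE /= (near fg y) // subrr normr0 mulr_ge0 ?(ltW eps0) //.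
Unshelve. all: by end_near. Qed.


(** The error (c y - c x) (g y - g x) of the linearization is a product of a
term tending to 0 and a Lipschitz term, whence superlinear; so [c] need only
be continuous. *)
Lemma differentiable_cts_mul (c g : V -> R) (x : V) :
  {for x, continuous c} -> differentiable g x ->
  differentiable (fun y => c y * (g y - g x)) x /\
  forall v, 'D_v (fun y => c y * (g y - g x)) x = c x * 'D_v g x.
Proof.
move=> cc dg.
pose l : V -> R := fun y => c x *: (g y - g x).
pose e : V -> R := fun y => (c y - c x) * (g y - g x).
have -> : (fun y => c y * (g y - g x)) = l + e.
  apply/funext => y; rewrite fctE /l /e -[c x *: _]/(c x * _) -mulrDl.
  by rewrite [c x + _]addrC subrK.
have dgx : differentiable (fun y => g y - g x) x.
  by apply: differentiableB => //; exact: differentiable_cst.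
have dl : differentiable l x by exact: differentiableZ.
have [de De] : differentiable e x /\ forall v, 'D_v e x = 0.
  apply: differentiable_superlinear; first by rewrite /e subrr mul0r.
  move=> eps eps0.
  have [k k0 Hk] : exists2 k, 0 < k & \forall y \near x, `|g y - g x| <= k * `|y - x|.
    have [k k0 kP] := linear_lipschitz (diff_continuous dg).
    exists (k + 1); first by rewrite addr_gt0.
    have := diff_locally dg => /eqaddoP /(_ 1 ltr01) H.
    rewrite (near_shift 0 x) /=.
    apply: filterS H => h /=.
    rewrite subr0 addrK !fctE /= opprD addrA mul1r => H.
    rewrite mulrDl mul1r -[g _ - g x](subrK ('d g x h)) addrC.
    by rewrite (le_trans (ler_normD _ _)) // lerD.
  have Hc : \forall y \near x, `|c y - c x| <= eps / k.
    have /cvgr_distC_le := cc; apply; exact: divr_gt0.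
  near=> y; rewrite /e normrM.
  apply: (@le_trans _ _ ((eps / k) * (k * `|y - x|))).
    by apply: ler_pM => //; [near: y|near: y].
  by rewrite mulrA divfK ?gt_eqF.
split; first exact: differentiableD.
move=> v; rewrite deriveD; [|exact: diff_derivable..].
rewrite De addr0 deriveZ; last exact: diff_derivable.
congr (_ * _); rewrite deriveB; [|exact: diff_derivable..].
  by rewrite derive_cst subr0.
Unshelve. all: by end_near. Qed.

(** Differentiability in the form of Caratheodory: an increment of [f] is a
continuous combination of increments of differentiable functions. *)
Lemma differentiable_cts_sum (n : nat) (f : V -> R) (c g : 'I_n -> V -> R)
    (x : V) :
  (forall i, {for x, continuous (c i)}) -> (forall i, differentiable (g i) x) ->
  (\forall y \near x, f y = f x + \sum_i c i y * (g i y - g i x)) ->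
  differentiable f x /\ forall v, 'D_v f x = \sum_i c i x * 'D_v (g i) x.
Proof.
move=> cc dg fE.
pose h i y := c i y * (g i y - g i x).
have dh i : differentiable (h i) x := (differentiable_cts_mul (cc i) (dg i)).1.
pose F : V -> R := cst (f x) + \sum_i h i.
have FE y : F y = f x + \sum_i c i y * (g i y - g i x).
  by rewrite /F fctE fct_sumE.
have Ff : \forall y \near x, F y = f y by apply: filterS fE => y ->.
have dF : differentiable F x.
  apply: differentiableD; first exact: differentiable_cst.
  exact: differentiable_sum.
split; first exact: near_eq_differentiable dF.
move=> v; rewrite -(near_eq_derive _ Ff) deriveD; last 2 first.
- exact: derivable_cst.
- by apply: diff_derivable; exact: differentiable_sum.
rewrite derive_cst add0r derive_sum => [|i]; last exact: diff_derivable.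
by apply: eq_bigr => i _; rewrite (differentiable_cts_mul (cc i) (dg i)).2.
Qed.

End Differentials.

(** * Closure properties of maps of class C^k *)

Section Ck.
Variables (R : realType) (V : normedModType R).
Implicit Types (O : set V) (k : nat).

Lemma Ck_ext (W : normedModType R) k O (f g : V -> W) : open O ->
  (forall x, O x -> f x = g x) -> Ck_on k O f -> Ck_on k O g.
Proof.
move=> oO; elim: k f g => [|k IH] f g fg /=.
  move=> cf x Ox; have nfg : \forall y \near x, f y = g y.
    by apply: filterS (open_nbhs_nbhs (conj oO Ox)) => y; exact: fg.
  rewrite /prop_for /continuous_at -(fg x Ox).
  by apply: cvg_trans (cf x Ox); exact: near_eq_cvg.
move=> [df Df]; split=> [x Ox|v].
  apply: near_eq_differentiable (df x Ox).
  by apply: filterS (open_nbhs_nbhs (conj oO Ox)) => y; exact: fg.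
apply: IH (Df v) => x Ox; apply: near_eq_derive.
by apply: filterS (open_nbhs_nbhs (conj oO Ox)) => y; exact: fg.
Qed.

Lemma CkS (W : normedModType R) k O (f : V -> W) :
  Ck_on k.+1 O f -> Ck_on k O f.
Proof.
elim: k f => [|k IH] f [df Df].
  by move=> x Ox; apply: differentiable_continuous; exact: df.
by split=> // v; apply: IH; exact: Df.
Qed.

Lemma Ck_continuous (W : normedModType R) k O (f : V -> W) :
  Ck_on k O f -> forall x, O x -> {for x, continuous f}.
Proof. by elim: k f => [//|k IH] f /CkS; exact: IH. Qed.

Lemma Ck_cst (W : normedModType R) k O (a : W) : Ck_on k O (fun=> a).
Proof.
elim: k a => [|k IH] a; first by move=> x _; exact: cst_continuous.
split=> [x _|v]; first exact: differentiable_cst.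
suff -> : (fun x => 'D_v (fun=> a) x) = (fun=> 0 : W) by exact: IH.
by apply/funext => x; rewrite derive_cst.
Qed.

Lemma Ck_linear (W : normedModType R) k O (L : {linear V -> W}) :
  continuous L -> Ck_on k O L.
Proof.
move=> cL; case: k => [|k]; first by move=> x _; exact: cL.
split=> [x _|v]; first exact: linear_differentiable.
suff -> : (fun x => 'D_v L x) = (fun=> L v) by exact: Ck_cst.
by apply/funext => x; rewrite deriveE ?diff_lin //; exact: linear_differentiable.
Qed.

Lemma Ck_lin_comp (W W' : normedModType R) k O (L : {linear W -> W'})
    (f : V -> W) : continuous L -> open O ->
  Ck_on k O f -> Ck_on k O (L \o f).
Proof.
move=> cL oO; elim: k f => [|k IH] f /=.
  by move=> cf x Ox; apply: continuous_comp; [exact: cf|exact: cL].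
move=> [df Df]; split=> [x Ox|v].
  by apply: differentiable_comp; [exact: df|exact: linear_differentiable].
apply: Ck_ext (IH _ (Df v)) => // x Ox /=.
have dL := linear_differentiable (f x) cL.
have dLf := differentiable_comp (df x Ox) dL.
rewrite (deriveE _ dLf) (deriveE _ (df x Ox)).
by rewrite (diff_comp (df x Ox) dL) diff_lin.
Qed.

Lemma CkD (W : normedModType R) k O (f g : V -> W) : open O ->
  Ck_on k O f -> Ck_on k O g -> Ck_on k O (fun x => f x + g x).
Proof.
move=> oO; elim: k f g => [|k IH] f g /=.
  by move=> cf cg x Ox; apply: continuousD; [exact: cf|exact: cg].
move=> [df Df] [dg Dg]; split=> [x Ox|v].
  by apply: (@differentiableD _ _ _ f g); [exact: df|exact: dg].
apply: Ck_ext (IH _ _ (Df v) (Dg v)) => // x Ox /=.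
by rewrite (@deriveD _ _ _ f g) //; apply: diff_derivable; [exact: df|exact: dg].
Qed.

Lemma CkM k O (f g : V -> R) : open O ->
  Ck_on k O f -> Ck_on k O g -> Ck_on k O (fun x => f x * g x).
Proof.
move=> oO; elim: k f g => [|k IH] f g.
  by move=> cf cg x Ox; apply: continuousM; [exact: cf|exact: cg].
move=> Cf Cg; have [df Df] := Cf; have [dg Dg] := Cg; split=> [x Ox|v].
  by apply: (@differentiableM _ _ f g); [exact: df|exact: dg].
apply: Ck_ext (CkD oO (IH _ _ (CkS Cf) (Dg v)) (IH _ _ (CkS Cg) (Df v))) => // x Ox /=.
by rewrite (@deriveM _ _ f g) //; apply: diff_derivable; [exact: df|exact: dg].
Qed.

(** The formula D(1/f) = - Df (1/f)^2 expresses the derivative through the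
function itself, which is C^k by induction. *)
Lemma CkV k O (f : V -> R) : open O -> (forall x, O x -> f x != 0) ->
  Ck_on k O f -> Ck_on k O (fun x => (f x)^-1).
Proof.
move=> oO f0; elim: k => [|k IH].
  by move=> cf x Ox; apply: cvgV; [exact: f0|exact: cf].
move=> Cf; have [df Df] := Cf; split=> [x Ox|v].
  by apply: differentiableV; [exact: df|exact: f0].
have Cg := IH (CkS Cf).
apply: Ck_ext (CkM oO (Ck_cst k O (-1 : R)) (CkM oO (CkM oO Cg Cg) (Df v))) => // x Ox /=.
rewrite deriveV; [|exact: f0|exact/diff_derivable/df].
by rewrite -[RHS]/(_ * _) expr2 invfM mulN1r mulNr.
Qed.

(** As for the inverse, D(sqrt f) = Df / (2 sqrt f) bootstraps the regularity.
*)
Lemma Ck_sqrt k O (f : V -> R) : open O -> (forall x, O x -> 0 < f x) ->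
  Ck_on k O f -> Ck_on k O (fun x => Num.sqrt (f x)).
Proof.
move=> oO f0; elim: k => [|k IH].
  by move=> cf x Ox; apply: continuous_comp; [exact: cf|exact: sqrt_continuous].
move=> Cf; have [df Df] := Cf.
have dsqrt x : O x -> differentiable (@Num.sqrt R) (f x).
  move=> Ox; apply/derivable1_diffP; have := is_derive1_sqrt (f0 x Ox).
  by case.
split=> [x Ox|v].
  by apply: differentiable_comp; [exact: df|exact: dsqrt].
have Cg := IH (CkS Cf).
have g0 x : O x -> Num.sqrt (f x) != 0.
  by move=> Ox; rewrite gt_eqF // sqrtr_gt0 f0.
apply: Ck_ext (CkM oO (CkM oO (Ck_cst k O (2^-1 : R)) (CkV oO g0 Cg)) (Df v)) => // x Ox /=.
rewrite (deriveE _ (differentiable_comp (df x Ox) (dsqrt x Ox))).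
rewrite diff_comp ?(diff1E (dsqrt x Ox)) /=; [|exact: df|exact: dsqrt].
rewrite derive1E derive_sqrt ?f0 // deriveE; last exact: df.
by rewrite mulrC invfM.
Qed.

Lemma Ck_sum (I : Type) (r : seq I) (W : normedModType R) k O
    (f : I -> V -> W) : open O -> (forall i, Ck_on k O (f i)) ->
  Ck_on k O (fun x => \sum_(i <- r) f i x).
Proof.
move=> oO Cf; elim: r => [|i r IH].
  by apply: Ck_ext (Ck_cst k O (0 : W)) => // x _; rewrite big_nil.
by apply: Ck_ext (CkD oO (Cf i) IH) => // x _; rewrite big_cons.
Qed.

Lemma Ck_prod (I : Type) (r : seq I) k O (f : I -> V -> R) : open O ->
  (forall i, Ck_on k O (f i)) -> Ck_on k O (fun x => \prod_(i <- r) f i x).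
Proof.
move=> oO Cf; elim: r => [|i r IH].
  by apply: Ck_ext (Ck_cst k O (1 : R)) => // x _; rewrite big_nil.
by apply: Ck_ext (CkM oO (Cf i) IH) => // x _; rewrite big_cons.
Qed.

Lemma Ck_mxP m n k O (F : V -> 'M[R]_(m, n)) : open O ->
  Ck_on k O F <-> forall i j, Ck_on k O (fun x => F x i j).
Proof.
move=> oO; split=> [CF i j|CF].
  have lin : linear (fun M : 'M[R]_(m, n) => M i j) by move=> a A B; rewrite !mxE.
  pose L : {linear 'M[R]_(m, n) -> R} :=
    HB.pack (fun M : 'M[R]_(m, n) => M i j) (GRing.isLinear.Build _ _ _ _ _ lin).
  exact: (@Ck_lin_comp _ _ k O L F (@coord_continuous _ _ _ i j)).
have C i j : Ck_on k O (fun x => F x i j *: delta_mx i j : 'M[R]_(m, n)).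
  have lin : linear (fun a : R => a *: delta_mx i j : 'M[R]_(m, n)).
    by move=> a b c; rewrite scalerDl scalerA.
  pose L : {linear R -> 'M[R]_(m, n)} :=
    HB.pack (fun a : R => a *: delta_mx i j : 'M[R]_(m, n)) (GRing.isLinear.Build _ _ _ _ _ lin).
  exact: (@Ck_lin_comp _ _ k O L (fun x => F x i j) (@scalel_continuous _ _ _)).
apply: Ck_ext (Ck_sum (index_enum _) oO (fun i => Ck_sum (index_enum _) oO (C i))) => // x _.
by rewrite [RHS]matrix_sum_delta.
Qed.

Lemma Ck_mulmx m n p k O (F : V -> 'M[R]_(m, n)) (G : V -> 'M[R]_(n, p)) :
  open O -> Ck_on k O F -> Ck_on k O G -> Ck_on k O (fun x => F x *m G x).
Proof.
move=> oO /(Ck_mxP _ _ oO) CF /(Ck_mxP _ _ oO) CG.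
apply/Ck_mxP => // i j.
have := Ck_sum (index_enum _) oO (fun l => CkM oO (CF i l) (CG l j)).
by apply: Ck_ext => // x _; rewrite mxE.
Qed.

Lemma Ck_trmx m n k O (F : V -> 'M[R]_(m, n)) :
  open O -> Ck_on k O F -> Ck_on k O (fun x => (F x)^T).
Proof.
move=> oO /(Ck_mxP _ _ oO) CF; apply/Ck_mxP => // i j.
by apply: Ck_ext (CF j i) => // x _; rewrite mxE.
Qed.

Lemma Ck_scale (m n k : nat) O (f : V -> R) (F : V -> 'M[R]_(m, n)) :
  open O -> Ck_on k O f -> Ck_on k O F -> Ck_on k O (fun x => f x *: F x).
Proof.
move=> oO Cf /(Ck_mxP _ _ oO) CF; apply/Ck_mxP => // i j.
by apply: Ck_ext (CkM oO Cf (CF i j)) => // x _; rewrite mxE.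
Qed.

Lemma Ck_trace n k O (F : V -> 'M[R]_n) :
  open O -> Ck_on k O F -> Ck_on k O (fun x => \tr (F x)).
Proof.
by move=> oO /(Ck_mxP _ _ oO) CF; apply: Ck_sum.
Qed.

Lemma Ck_det n k O (F : V -> 'M[R]_n) :
  open O -> Ck_on k O F -> Ck_on k O (fun x => \det (F x)).
Proof.
move=> oO /(Ck_mxP _ _ oO) CF; apply: Ck_sum => // s.
by apply: CkM => //; [exact: Ck_cst|exact: Ck_prod].
Qed.

(** By the formula of Cramer, the entries of the inverse are quotients of
polynomials. *)
Lemma Ck_invmx n k O (F : V -> 'M[R]_n) : open O ->
  (forall x, O x -> F x \in unitmx) ->
  Ck_on k O F -> Ck_on k O (fun x => invmx (F x)).
Proof.
move=> oO F0 CF.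
have d0 x : O x -> \det (F x) != 0 by move=> /F0; rewrite unitmxE unitfE.
have Cadj : Ck_on k O (fun x => \adj (F x)).
  apply/Ck_mxP => // i j.
  have Cc : Ck_on k O (fun x => cofactor (F x) j i).
    apply: CkM => //; first exact: Ck_cst.
    apply: Ck_det => //; apply/Ck_mxP => // a b.
    move: CF => /(Ck_mxP _ _ oO) /(_ (lift j a) (lift i b)).
    by apply: Ck_ext => // x _; rewrite !mxE.
  by apply: Ck_ext Cc => // x _; rewrite mxE.
apply: Ck_ext (Ck_scale oO (CkV oO d0 (Ck_det oO CF)) Cadj) => // x Ox.
by rewrite /invmx F0.
Qed.

End Ck.

Section CkMaps.
Variable R : realType.

Lemma Ck_id (V : normedModType R) k (O : set V) : Ck_on k O id.
Proof. by apply: (@Ck_linear _ _ _ k O idfun) => x; exact: cvg_id. Qed.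

Lemma Ck_fst (V W : normedModType R) k O : Ck_on k O (fst : V * W -> V).
Proof.
have lin : linear (fst : V * W -> V) by [].
pose L : {linear (V * W)%type -> V} :=
  HB.pack (fst : V * W -> V) (GRing.isLinear.Build _ _ _ _ _ lin).
by apply: (@Ck_linear _ _ _ k O L) => x; exact: cvg_fst.
Qed.

Lemma Ck_snd (V W : normedModType R) k O : Ck_on k O (snd : V * W -> W).
Proof.
have lin : linear (snd : V * W -> W) by [].
pose L : {linear (V * W)%type -> W} :=
  HB.pack (snd : V * W -> W) (GRing.isLinear.Build _ _ _ _ _ lin).
by apply: (@Ck_linear _ _ _ k O L) => x; exact: cvg_snd.
Qed.

Lemma Ck_pair (V W W' : normedModType R) k (O : set V) (f : V -> W) (g : V -> W') :
  open O -> Ck_on k O f -> Ck_on k O g -> Ck_on k O (fun x => (f x, g x)).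
Proof.
move=> oO Cf Cg.
have lin1 : linear (fun a : W => (a, 0 : W')).
  by move=> c a b; congr pair; rewrite /= scaler0 addr0.
have lin2 : linear (fun a : W' => (0 : W, a)).
  by move=> c a b; congr pair; rewrite /= scaler0 addr0.
pose L1 : {linear W -> (W * W')%type} :=
  HB.pack (fun a : W => (a, 0 : W')) (GRing.isLinear.Build _ _ _ _ _ lin1).
pose L2 : {linear W' -> (W * W')%type} :=
  HB.pack (fun a : W' => (0 : W, a)) (GRing.isLinear.Build _ _ _ _ _ lin2).
have c1 : continuous L1 by move=> x; apply: cvg_pair; [exact: cvg_id|exact: cvg_cst].
have c2 : continuous L2 by move=> x; apply: cvg_pair; [exact: cvg_cst|exact: cvg_id].
have C := CkD oO (Ck_lin_comp c1 oO Cf) (Ck_lin_comp c2 oO Cg).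
apply: Ck_ext C => // x _ /=.
by congr pair; rewrite /= ?addr0 ?add0r.
Qed.

(** Continuity is read off from C^1; it is convenient to prove the hypothesis
for an arbitrary k. *)
Lemma Ck_smooth_continuous (V W : normedModType R) (f : V -> W) x :
  (forall k, Ck_on k setT f) -> {for x, continuous f}.
Proof. by move=> Cf; exact: Ck_continuous (Cf 1%N) x I. Qed.

End CkMaps.

(** * The spectral theorem for real symmetric matrices *)

Section LinearAlgebra.
Variable R : realType.

(** The squared Euclidean norm of the space of matrices, also used for row and
column vectors. *)
Definition sqn m n (X : 'M[R]_(m, n)) : R := \tr (X^T *m X).

Lemma sqnE m n (X : 'M[R]_(m, n)) : sqn X = \sum_j \sum_i X i j ^+ 2.
Proof.
by rewrite /sqn /mxtrace; apply: eq_bigr => j _; rewrite mxE; apply: eq_bigr => i _; rewrite mxE expr2.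
Qed.

Lemma sqn_ge0 m n (X : 'M[R]_(m, n)) : 0 <= sqn X.
Proof. by rewrite sqnE; do 2!apply: sumr_ge0 => ? _; exact: sqr_ge0. Qed.

Lemma sqr_le_sqn m n (X : 'M[R]_(m, n)) i j : X i j ^+ 2 <= sqn X.
Proof.
rewrite sqnE (bigD1 j) //= (bigD1 i) //= -addrA lerDl addr_ge0 //.
  by apply: sumr_ge0 => ? _; exact: sqr_ge0.
by do 2!apply: sumr_ge0 => ? _; exact: sqr_ge0.
Qed.

Lemma sqn_eq0 m n (X : 'M[R]_(m, n)) : sqn X = 0 -> X = 0.
Proof.
move=> X0; apply/matrixP => i j; rewrite mxE; apply/eqP.
by rewrite -sqrf_eq0 eq_le sqr_ge0 andbT -X0 sqr_le_sqn.
Qed.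

Lemma sqn_gt0 m n (X : 'M[R]_(m, n)) : X != 0 -> 0 < sqn X.
Proof.
by move=> X0; rewrite lt0r sqn_ge0 andbT; apply: contra X0 => /eqP/sqn_eq0 ->.
Qed.

Lemma sqn0 m n : sqn (0 : 'M[R]_(m, n)) = 0.
Proof. by rewrite /sqn mulmx0 mxtrace0. Qed.

Lemma sqnZ m n a (X : 'M[R]_(m, n)) : sqn (a *: X) = a ^+ 2 * sqn X.
Proof. by rewrite /sqn -scalemxAr [(a *: X)^T]linearZ /= -scalemxAl scalerA mxtraceZ expr2. Qed.

Lemma sqn_mul_orth m n p (U : 'M[R]_(p, m)) (X : 'M[R]_(m, n)) :
  U^T *m U = 1%:M -> sqn (U *m X) = sqn X.
Proof. by move=> UU; rewrite /sqn trmx_mul mulmxA -(mulmxA X^T) UU mulmx1. Qed.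

Lemma sqn_mul_orthr m n p (X : 'M[R]_(m, n)) (W : 'M[R]_(n, p)) :
  W *m W^T = 1%:M -> sqn (X *m W) = sqn X.
Proof.
move=> WW; rewrite /sqn trmx_mul -mulmxA mxtrace_mulC -!mulmxA WW mulmx1.
by [].
Qed.

Lemma mxtrace_tr_mul m n (X Y : 'M[R]_(m, n)) : \tr (Y^T *m X) = \tr (X^T *m Y).
Proof. by rewrite -mxtrace_tr trmx_mul trmxK. Qed.

Lemma mxtraceB n (X Y : 'M[R]_n) : \tr (X - Y) = \tr X - \tr Y.
Proof. exact: linearB. Qed.

Lemma trmxB m n (X Y : 'M[R]_(m, n)) : (X - Y)^T = X^T - Y^T.
Proof. exact: linearB. Qed.

Lemma trmxD m n (X Y : 'M[R]_(m, n)) : (X + Y)^T = X^T + Y^T.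
Proof. exact: linearD. Qed.

Lemma trmxN m n (X : 'M[R]_(m, n)) : (- X)^T = - X^T.
Proof. exact: linearN. Qed.

Lemma mx11_trace (X : 'M[R]_1) : X = (\tr X)%:M.
Proof. by rewrite [LHS]mx11_scalar /mxtrace big_ord1. Qed.

Lemma trmxZ m n a (X : 'M[R]_(m, n)) : (a *: X)^T = a *: X^T.
Proof. exact: linearZ. Qed.

Lemma sqnB m n (X Y : 'M[R]_(m, n)) :
  sqn (X - Y) = sqn X - 2 * \tr (X^T *m Y) + sqn Y.
Proof.
rewrite /sqn [(X - Y)^T]linearB /= mulmxBl !mulmxBr !mxtraceB (mxtrace_tr_mul X Y).
ring.
Qed.

(** Quadratic forms are written as traces, so that they apply to a matrix as
to its columns. *)
Definition posdef n (A : 'M[R]_n) : Prop :=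
  A^T = A /\ forall v : 'cV[R]_n, v != 0 -> 0 < \tr (v^T *m A *m v).

Lemma reflection_orthogonal n (w : 'rV[R]_n) : w != 0 ->
  let H := 1%:M - (2 / sqn w) *: (w^T *m w) in
  H^T = H /\ H *m H = 1%:M.
Proof.
move=> w0 H.
have ww : w *m w^T = (sqn w)%:M.
  by rewrite (mx11_trace (w *m _)) mxtrace_mulC.
split; first by rewrite /H trmxB trmx1 trmxZ trmx_mul trmxK.
rewrite /H mulmxBl mul1mx mulmxBr mulmx1 -scalemxAl -scalemxAr.
rewrite !mulmxA -(mulmxA w^T) ww mul_mx_scalar -scalemxAl !scalerA.
rewrite -[RHS]subr0 -addrA; congr (_ + _); rewrite -opprD; congr (- _).
rewrite -scalerBl -scalerDl [X in X *: _](_ : _ = 0) ?scale0r //.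
by have := sqn_gt0 w0; move=> /lt0r_neq0 ?; field.
Qed.

(** Either [u] is the first basis vector, or the reflection along the
difference of the two exchanges them. *)
Lemma orthogonal_with_first_row n (u : 'rV[R]_n.+1) : sqn u = 1 ->
  exists Q : 'M[R]_n.+1, Q *m Q^T = 1%:M /\ delta_mx 0 0 *m Q = u.
Proof.
move=> u1; pose e : 'rV[R]_n.+1 := delta_mx 0 0.
have [ue|] := eqVneq (u - e) 0.
  exists 1%:M; rewrite trmx1 !mulmx1; split=> //.
  by apply/esym/eqP; rewrite -subr_eq0 ue.
move=> w0; have [HT HH] := reflection_orthogonal w0.
set w := u - e in w0 HT HH; set H := 1%:M - _ in HT HH.
exists H; split; first by rewrite HT.
have e1 : sqn e = 1.
  by rewrite /sqn mxtrace_mulC trmx_delta mul_delta_mx /mxtrace big_ord1 mxE !eqxx.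
have sw : sqn w = 2 - 2 * \tr (u^T *m e) by rewrite sqnB u1 e1; ring.
have ew : e *m w^T = (\tr (u^T *m e) - 1)%:M.
  by rewrite (mx11_trace (e *m _)) mxtrace_mulC /w trmxB mulmxBl mxtraceB -e1.
rewrite /H mulmxBr mulmx1 -scalemxAr mulmxA -/e ew mul_scalar_mx scalerA.
rewrite [X in X *: _](_ : _ = -1); first by rewrite scaleN1r opprK addrC subrK.
have := sqn_gt0 w0; rewrite sw => /lt0r_neq0 h.
have h' : 1 - \tr (u^T *m e) != 0 by apply: contra h => /eqP h; apply/eqP; lra.
field.
by rewrite h.
Qed.

(** The nonnegative trinomial is evaluated at - b / (c + 1), where its sign is
that of - b ^+ 2. *)
Lemma quad_le_linear0 (b c : R) : 0 <= c ->
  (forall t : R, 0 <= 2 * t * b + t ^+ 2 * c) -> b = 0.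
Proof.
move=> c0 /(_ (- b / (c + 1))).
have c1 : 0 < c + 1 by rewrite ltr_wpDl.
have -> : 2 * (- b / (c + 1)) * b + (- b / (c + 1)) ^+ 2 * c =
  - (b ^+ 2 * (c + 2) / (c + 1) ^+ 2) by field; rewrite gt_eqF.
rewrite oppr_ge0 pmulr_lle0 ?invr_gt0 ?exprn_gt0 // pmulr_lle0 ?ltr_wpDl //.
by rewrite exprn_even_le0 //= => /eqP.
Qed.

(** A maximum [u] of the quadratic form of [A] on the unit sphere, which is
compact, is an eigenvector: if [l] is the maximum, the form of B = l - A is
nonnegative and vanishes at [u], which forces u B = 0. *)
Lemma symmetric_eigenvector n (A : 'M[R]_n.+1) : A^T = A ->
  exists (u : 'rV[R]_n.+1) (l : R), sqn u = 1 /\ u *m A = l *: u.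
Proof.
move=> AT.
pose q (u : 'rV[R]_n.+1) : R := \tr (u *m A *m u^T).
pose S : set 'rV[R]_n.+1 := [set u | sqn u = 1].
have cq : Ck_on 0 setT q.
  apply: Ck_trace; first exact: openT.
  apply: Ck_mulmx; first exact: openT.
    apply: Ck_mulmx; [exact: openT|exact: Ck_id|exact: Ck_cst].
  by apply: Ck_trmx; [exact: openT|exact: Ck_id].
have cn : Ck_on 0 setT (@sqn 1 n.+1).
  apply: Ck_trace; first exact: openT.
  apply: Ck_mulmx; [exact: openT| |exact: Ck_id].
  by apply: Ck_trmx; [exact: openT|exact: Ck_id].
have S0 : S !=set0.
  exists (delta_mx 0 0); rewrite /S /= /sqn mxtrace_mulC trmx_delta mul_delta_mx.
  by rewrite /mxtrace big_ord1 mxE !eqxx.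
have cS : compact S.
  apply: bounded_closed_compact.
    exists 1; split; first exact: num_real.
    move=> x x1 u Su; apply: le_trans (ltW x1).
    rewrite [leLHS]/Num.Def.normr /= mx_normrE; apply: bigmax_le => // -[i j] _ /=.
    by rewrite -(@ler_pXn2r _ 2) ?nnegrE // real_normK ?num_real // expr1n -Su sqr_le_sqn.
  rewrite (_ : S = @sqn 1 n.+1 @^-1` [set 1]) //.
  apply: closed_comp; last exact: closed_eq.
  by move=> x _; apply: cn.
have wq : {within S, continuous q}.
  by apply: continuous_in_subspaceT => x _; exact: cq.
have [u /set_mem Su umax] := EVT_max_rV S0 cS wq.
pose l := q u; exists u, l; split => //.
(* The matrix is kept abstract, so that expansions do not unfold it. *)
have [B BE] : exists B, B = l%:M - A by exists (l%:M - A).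
have Bq (w : 'rV[R]_n.+1) : \tr (w *m B *m w^T) = l * sqn w - q w.
  rewrite BE mulmxBr mulmxBl mxtraceB mul_mx_scalar -scalemxAl mxtraceZ.
  by rewrite mxtrace_mulC.
have Bge0 (w : 'rV[R]_n.+1) : 0 <= \tr (w *m B *m w^T).
  rewrite Bq subr_ge0; have [->|w0] := eqVneq w 0.
    by rewrite /q mul0mx mul0mx mxtrace0 sqn0 mulr0.
  have sw := sqn_gt0 w0.
  pose a := (Num.sqrt (sqn w))^-1.
  have a2 : a ^+ 2 = (sqn w)^-1 by rewrite exprVn sqr_sqrtr // ltW.
  have : q (a *: w) <= l.
    by apply: umax; apply: mem_set; rewrite /S /= sqnZ a2 mulVf // gt_eqF.
  rewrite /q trmxZ -!scalemxAl -scalemxAr scalerA mxtraceZ -expr2 a2.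
  by rewrite ler_pdivrMl // mulrC.
have BT : B^T = B by rewrite BE trmxB tr_scalar_mx AT.
suff uB : u *m B = 0.
  by apply/esym/eqP; rewrite -subr_eq0 -mul_mx_scalar -mulmxBr -BE uB.
apply: sqn_eq0; apply: (@quad_le_linear0 _ (\tr ((u *m B) *m B *m (u *m B)^T))) => //.
move=> t; have := Bge0 (u + t *: (u *m B)).
rewrite mulmxDl trmxD mulmxDl !mulmxDr !mxtraceD.
rewrite Bq Su mulr1 /l subrr add0r.
rewrite trmxZ -!scalemxAl -!scalemxAr !mxtraceZ.
rewrite /sqn [\tr ((_)^T *m (u *m B))]mxtrace_mulC trmx_mul BT.
rewrite -(mxtrace_tr (u *m B *m B *m u^T)) !trmx_mul !trmxK BT !mulmxA => H.
apply: le_trans H _; rewrite le_eqVlt; apply/orP; left; apply/eqP; ring.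
Qed.

(** Induction on the size: an orthogonal matrix whose first row is a unit
eigenvector conjugates [A] to a symmetric block matrix with blocks of sizes 1
and n. *)
Lemma spectral_theorem n (A : 'M[R]_n) : A^T = A ->
  exists (U : 'M[R]_n) (d : 'rV[R]_n),
    U^T *m U = 1%:M /\ A = U *m diag_mx d *m U^T.
Proof.
elim: n A => [|n IH] A AT.
  by exists 1%:M, 0; split; [rewrite trmx1 mulmx1|rewrite !thinmx0].
have [u [l [u1 uA]]] := symmetric_eigenvector AT.
have [Q [QQ Qu]] := orthogonal_with_first_row u1.
have QQ' : Q^T *m Q = 1%:M by exact: mulmx1C.
(* As a block matrix of sizes 1 and n; its first row is l times the first basis vector. *)
have [M MdE] : exists M : 'M[R]_(1 + n), M = Q *m A *m Q^T by eexists.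
have MT : M^T = M by rewrite MdE !trmx_mul trmxK AT mulmxA.
have eM : delta_mx 0 0 *m M = l *: (delta_mx 0 0 : 'rV_(1 + n)).
  by rewrite MdE !mulmxA Qu uA -scalemxAl -Qu -mulmxA QQ mulmx1.
have l0 : lshift n (0 : 'I_1) = 0 by apply/val_inj.
have M0 j : M (lshift n 0) j = l * (j == lshift n 0)%:R.
  rewrite l0.
  have := congr1 (fun X : 'rV_(1 + n) => X 0 j) eM.
  by rewrite -rowE !mxE eqxx.
have DT : (drsubmx M)^T = drsubmx M by rewrite trmx_drsub MT.
have [U' [d' [UU' DE]]] := IH (drsubmx M) DT.
have ur : ursubmx M = 0.
  apply/matrixP => i j; rewrite !mxE ord1 M0 [_ == _](_ : _ = false) ?mulr0 //.
have dl : dlsubmx M = 0 by rewrite -[dlsubmx M]trmxK trmx_dlsub MT ur trmx0.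
have ul : ulsubmx M = l%:M.
  by apply/matrixP => i j; rewrite !mxE !ord1 M0 !eqxx mulr1.
pose W : 'M[R]_(1 + n) := block_mx 1%:M 0 0 U'.
have WW : W^T *m W = 1%:M.
  rewrite /W tr_block_mx mulmx_block !trmx0 !trmx1 !mulmx0 !mul0mx !mulmx1.
  by rewrite !addr0 !add0r UU' -scalar_mx_block.
have ME : M = W *m diag_mx (row_mx l%:M d') *m W^T.
  rewrite -[LHS]submxK ul ur dl DE /W tr_block_mx diag_mx_row !mulmx_block.
  rewrite !trmx0 !trmx1 !mulmx0 !mul0mx !mulmx1 !addr0 !add0r !mul0mx !mul1mx.
  by congr block_mx; apply/matrixP => i j; rewrite !ord1 !mxE.
exists (Q^T *m W), (row_mx l%:M d'); split.
  by rewrite trmx_mul trmxK -mulmxA (mulmxA Q) QQ mul1mx.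
rewrite trmx_mul trmxK !mulmxA -(mulmxA Q^T W) -(mulmxA Q^T _ W^T) -ME MdE.
by rewrite !mulmxA QQ' mul1mx -mulmxA QQ' mulmx1.
Qed.
End LinearAlgebra.

(** * Positive definite matrices and their square roots *)

Section Posdef.
Variable R : realType.

Lemma mxtrace_conj_diag m n (U : 'M[R]_m) (d : 'rV[R]_m) (X : 'M[R]_(m, n)) :
  \tr (X^T *m (U *m diag_mx d *m U^T) *m X) =
  \sum_j \sum_i d 0 i * (U^T *m X) i j ^+ 2.
Proof.
have -> : X^T *m (U *m diag_mx d *m U^T) *m X =
  (U^T *m X)^T *m (diag_mx d *m (U^T *m X)) by rewrite trmx_mul trmxK !mulmxA.
move: (U^T *m X) => Y.
rewrite /mxtrace; apply: eq_bigr => j _; rewrite mul_diag_mx mxE.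
by apply: eq_bigr => i _; rewrite !mxE expr2 mulrCA.
Qed.

Lemma posdef_diag n (U : 'M[R]_n) (d : 'rV[R]_n) : U^T *m U = 1%:M ->
  posdef (U *m diag_mx d *m U^T) <-> forall i, 0 < d 0 i.
Proof.
move=> UU; have UU' := mulmx1C UU; split=> [[_ pos] i|d0].
  have v0 : U *m (delta_mx i 0 : 'cV_n) != 0.
    apply/eqP => /(congr1 (mulmx U^T)); rewrite mulmxA UU mul1mx mulmx0.
    move=> /matrixP /(_ i 0); rewrite !mxE !eqxx => /eqP; rewrite oner_eq0 //.
  have := pos _ v0; rewrite mxtrace_conj_diag mulmxA UU mul1mx big_ord1.
  rewrite (bigD1 i) //= !mxE !eqxx expr1n mulr1 big1 ?addr0 // => j ji.
  by rewrite mxE (negPf ji) expr0n mulr0.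
split; first by rewrite !trmx_mul trmxK tr_diag_mx mulmxA.
move=> v v0; have w0 : U^T *m v != 0.
  apply: contra v0 => /eqP /(congr1 (mulmx U)).
  by rewrite mulmxA UU' mul1mx mulmx0 => ->.
rewrite mxtrace_conj_diag big_ord1; have [i wi] : exists i, (U^T *m v) i 0 != 0.
  apply/existsP; apply: contraR w0; rewrite negb_exists => /forallP w0.
  by apply/eqP/colP => i; rewrite [RHS]mxE; have := w0 i; rewrite negbK => /eqP.
rewrite (bigD1 i) //= ltr_pwDl //.
  by rewrite mulr_gt0 // lt0r sqr_ge0 sqrf_eq0 wi.
by apply: sumr_ge0 => j _; rewrite mulr_ge0 ?sqr_ge0 // ltW.
Qed.

Lemma posdef_spectral n (A : 'M[R]_n) : posdef A ->
  exists (U : 'M[R]_n) (d : 'rV[R]_n),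
    [/\ U^T *m U = 1%:M, A = U *m diag_mx d *m U^T & forall i, 0 < d 0 i].
Proof.
move=> pA; have [U [d [UU AE]]] := spectral_theorem pA.1.
by exists U, d; split=> //; apply/(posdef_diag _ UU); rewrite -AE.
Qed.

Lemma det_posdef n (A : 'M[R]_n) : posdef A -> 0 < \det A.
Proof.
move=> /posdef_spectral [U [d [UU -> d0]]].
rewrite !det_mulmx mulrAC -det_mulmx (mulmx1C UU) det1 mul1r det_diag.
by rewrite prodr_gt0.
Qed.

Lemma posdef_unit n (A : 'M[R]_n) : posdef A -> A \in unitmx.
Proof. by move=> /det_posdef dA; rewrite unitmxE unitfE gt_eqF. Qed.

Lemma posdef_sqn_gt0 n (A : 'M[R]_n.+1) : posdef A -> 0 < sqn A.
Proof.
move=> /det_posdef dA; rewrite sqn_gt0 //; apply/eqP => A0.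
by rewrite A0 det0 ltxx in dA.
Qed.

Lemma posdef_congr n (A B : 'M[R]_n) : posdef A -> B \in unitmx ->
  posdef (B^T *m A *m B).
Proof.
move=> [AT Apos] uB; split; first by rewrite !trmx_mul trmxK AT mulmxA.
move=> v v0; have := Apos (B *m v); rewrite trmx_mul !mulmxA; apply.
by apply: contra v0 => /eqP /(congr1 (mulmx (invmx B))); rewrite mulKmx // mulmx0 => ->.
Qed.

Lemma posdef1 n : posdef (1%:M : 'M[R]_n).
Proof. by split=> [|v v0]; rewrite ?trmx1 // mulmx1; exact: sqn_gt0. Qed.

Lemma posdef_gram n (A : 'M[R]_n) : A \in unitmx -> posdef (A^T *m A).
Proof. by move=> uA; rewrite -(mulmx1 A^T); apply: posdef_congr => //; exact: posdef1. Qed.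

Lemma posdef_inv n (A : 'M[R]_n) : posdef A -> posdef (invmx A).
Proof.
move=> pA; have uA := posdef_unit pA.
have -> : invmx A = (invmx A)^T *m A *m invmx A.
  by rewrite -mulmxA mulmxV // mulmx1 trmx_inv pA.1.
by apply: posdef_congr; rewrite ?unitmx_inv.
Qed.

Lemma posdefZ n a (A : 'M[R]_n) : 0 < a -> posdef A -> posdef (a *: A).
Proof.
move=> a0 [AT Apos]; split; first by rewrite trmxZ AT.
by move=> v v0; rewrite -scalemxAr -scalemxAl mxtraceZ mulr_gt0 // Apos.
Qed.

Lemma posdefD n (A B : 'M[R]_n) : posdef A -> posdef B -> posdef (A + B).
Proof.
move=> [AT Apos] [BT Bpos]; split; first by rewrite trmxD AT BT.
by move=> v v0; rewrite mulmxDr mulmxDl mxtraceD addr_gt0 ?Apos ?Bpos.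
Qed.

Lemma posdef_mxtrace_gt0 n (A : 'M[R]_n.+1) : posdef A -> 0 < \tr A.
Proof.
move=> /posdef_spectral [U [d [UU -> d0]]].
rewrite mxtrace_mulC mulmxA UU mul1mx mxtrace_diag.
by rewrite (bigD1 0) //= ltr_pwDl // sumr_ge0 // => i _; exact: ltW.
Qed.

Lemma posdef_1Dsqr n (S : 'M[R]_n) : S^T = S -> posdef (1%:M + S *m S).
Proof.
move=> ST; split; first by rewrite trmxD trmx1 trmx_mul ST.
move=> v v0; rewrite mulmxDr mulmx1 mulmxDl mxtraceD ltr_pwDl //; first exact: sqn_gt0.
suff -> : v^T *m (S *m S) *m v = (S *m v)^T *m (S *m v) by exact: sqn_ge0.
by rewrite trmx_mul ST !mulmxA.
Qed.

(** A diagonal entry is at least the inverse of one plus the sum of the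
inverses of all of them; this avoids taking a minimum. *)
Lemma posdef_coercive n (A : 'M[R]_n) : posdef A ->
  exists2 c : R, 0 < c &
    forall m (X : 'M[R]_(n, m)), c * sqn X <= \tr (X^T *m A *m X).
Proof.
move=> /posdef_spectral [U [d [UU -> d0]]].
pose s : R := 1 + \sum_i (d 0 i)^-1.
have s0 : 0 < s.
  by rewrite ltr_pwDl // sumr_ge0 // => i _; rewrite invr_ge0 ltW.
exists s^-1 => [|m X]; first by rewrite invr_gt0.
have <- : sqn (U^T *m X) = sqn X.
  by rewrite sqn_mul_orth // trmxK; exact: mulmx1C.
rewrite mxtrace_conj_diag sqnE mulr_sumr ler_sum // => j _.
rewrite mulr_sumr ler_sum // => i _; apply: ler_wpM2r; first exact: sqr_ge0.
rewrite -[d 0 i]invrK lef_pV2 ?posrE ?invr_gt0 //.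
rewrite /s (bigD1 i) //= addrCA lerDl addr_ge0 // sumr_ge0 // => k _.
by rewrite invr_ge0 ltW.
Qed.

Lemma posdef_mxtrace_ge0 n m (A : 'M[R]_n) (X : 'M[R]_(n, m)) :
  posdef A -> 0 <= \tr (X^T *m A *m X).
Proof.
move=> /posdef_coercive [c c0 /(_ _ X)]; apply: le_trans.
by rewrite mulr_ge0 ?sqn_ge0 // ltW.
Qed.

(** If H = P X + X Q, pairing with X gives c |X|^2 <= <X, H>, because the form
of [Q] is nonnegative and [P] has a coercivity constant [c]. Then <X, H> is
absorbed by expanding 0 <= |c X - H|^2. The bound does not depend on [Q]. *)
Lemma sylvester_bound n (P : 'M[R]_n) : posdef P ->
  exists2 c : R, 0 < c & forall Q X : 'M[R]_n, posdef Q ->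
    sqn X <= c * sqn (P *m X + X *m Q).
Proof.
move=> /posdef_coercive [c c0 cP]; exists (c ^- 2); first by rewrite invr_gt0 exprn_gt0.
move=> Q X pQ; rewrite ler_pdivlMl ?exprn_gt0 //.
set H := P *m X + X *m Q.
have h1 : c * sqn X <= \tr (X^T *m H).
  rewrite /H mulmxDr mxtraceD mulmxA (le_trans (cP _ X)) // lerDl.
  rewrite mxtrace_mulC -{1}[X]trmxK.
  exact: posdef_mxtrace_ge0.
have := sqn_ge0 (c *: X - H).
rewrite sqnB sqnZ trmxZ -scalemxAl mxtraceZ => h2.
have h3 : 2 * c * (c * sqn X) <= 2 * c * \tr (X^T *m H).
  by rewrite ler_pM2l // mulr_gt0.
by nra.
Qed.

Lemma sylvester_inj n (P Q X : 'M[R]_n) : posdef P -> posdef Q ->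
  P *m X + X *m Q = 0 -> X = 0.
Proof.
move=> /sylvester_bound [c _ cP] pQ X0; apply/sqn_eq0/eqP.
by rewrite eq_le sqn_ge0 andbT; have := cP Q X pQ; rewrite X0 sqn0 mulr0.
Qed.

(** The matrix of X |-> P X + X Q on vectorized matrices, so that the inverse
of this operator has entries that are rational in those of [P] and [Q]. *)
Definition sylvester_mx n (P Q : 'M[R]_n) : 'M[R]_(n * n) :=
  lin_mulmx P + lin_mulmxr Q.

Lemma mul_sylvester_mx n (P Q X : 'M[R]_n) :
  mxvec X *m sylvester_mx P Q = mxvec (P *m X + X *m Q).
Proof. by rewrite mulmxDr !mul_vec_lin /= linearD. Qed.

Lemma sylvester_mx_unit n (P Q : 'M[R]_n) : posdef P -> posdef Q ->
  sylvester_mx P Q \in unitmx.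
Proof.
move=> pP pQ; rewrite -row_free_unit -kermx_eq0; apply/rowV0P => v /sub_kermxP.
rewrite -[v]vec_mxK mul_sylvester_mx => /eqP; rewrite mxvec_eq0 => /eqP.
by move=> /(sylvester_inj pP pQ) ->; rewrite linear0.
Qed.

Lemma sylvester_solve n (P Q X : 'M[R]_n) : posdef P -> posdef Q ->
  mxvec X = mxvec (P *m X + X *m Q) *m invmx (sylvester_mx P Q).
Proof.
by move=> pP pQ; rewrite -mul_sylvester_mx mulmxK // sylvester_mx_unit.
Qed.

Definition sqrtmx n (A : 'M[R]_n) : 'M[R]_n :=
  xget 0 [set P | posdef P /\ P *m P = A].

Lemma posdef_sqrt_ex n (A : 'M[R]_n) : posdef A ->
  exists P, posdef P /\ P *m P = A.
Proof.
move=> /posdef_spectral [U [d [UU -> d0]]].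
pose e : 'rV[R]_n := \row_i Num.sqrt (d 0 i).
exists (U *m diag_mx e *m U^T); split.
  by apply/posdef_diag => // i; rewrite mxE sqrtr_gt0.
rewrite !mulmxA -(mulmxA _ U^T U) UU mulmx1 -(mulmxA U) mulmx_diag.
congr (_ *m diag_mx _ *m _); apply/rowP => i.
by rewrite !mxE -expr2 sqr_sqrtr // ltW.
Qed.

Lemma sqrtmxP n (A : 'M[R]_n) : posdef A ->
  posdef (sqrtmx A) /\ sqrtmx A *m sqrtmx A = A.
Proof.
move=> /posdef_sqrt_ex [P PP].
exact: (@xgetPex _ 0 [set P | posdef P /\ P *m P = A] (ex_intro _ P PP)).
Qed.

Lemma posdef_sqr n (P : 'M[R]_n) : posdef P -> posdef (P *m P).
Proof. by move=> pP; rewrite -{1}pP.1; apply: posdef_gram; exact: posdef_unit. Qed.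

Lemma sqrtmx_sqr n (P : 'M[R]_n) : posdef P -> sqrtmx (P *m P) = P.
Proof.
move=> pP; have [pQ QQ] := sqrtmxP (posdef_sqr pP).
set Q := sqrtmx _ in pQ QQ *; apply/eqP; rewrite -subr_eq0; apply/eqP.
apply: (sylvester_inj pQ pP).
by rewrite mulmxBr mulmxBl QQ addrA subrK subrr.
Qed.

Variable V : normedModType R.

Lemma Ck_sylvester_mx n k (O : set V) (P Q : V -> 'M[R]_n) : open O ->
  Ck_on k O P -> Ck_on k O Q -> Ck_on k O (fun x => sylvester_mx (P x) (Q x)).
Proof.
move=> oO CP CQ; apply/Ck_mxP => // i j.
case/mxvec_indexP: j => a b; pose E : 'M[R]_n := vec_mx (delta_mx 0 i).
have C : Ck_on k O (fun x => P x *m E + E *m Q x).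
  by apply: CkD => //; apply: Ck_mulmx => //; exact: Ck_cst.
move: C => /(Ck_mxP _ _ oO) /(_ a b).
apply: Ck_ext => // x _.
have -> : sylvester_mx (P x) (Q x) i (mxvec_index a b) =
    ((delta_mx 0 i : 'rV_(n * n)) *m sylvester_mx (P x) (Q x)) 0 (mxvec_index a b).
  by rewrite -rowE [RHS]mxE.
by rewrite -[delta_mx 0 i : 'rV_(n * n)]vec_mxK mul_sylvester_mx mxvecE.
Qed.

Lemma Ck_mxvec n k (O : set V) (G : V -> 'M[R]_n) l : open O ->
  Ck_on k O G -> Ck_on k O (fun x => mxvec (G x) 0 l).
Proof.
move=> oO /(Ck_mxP _ _ oO) CG; case/mxvec_indexP: l => a b.
by apply: Ck_ext (CG a b) => // x _; rewrite mxvecE.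
Qed.

Lemma Ck_sqnB n k (O : set V) (G : V -> 'M[R]_n) c M : open O ->
  Ck_on k O G -> Ck_on k O (fun y => c * sqn (G y - M)).
Proof.
move=> oO CG.
have CGM : Ck_on k O (fun y => G y - M) by apply: CkD => //; exact: Ck_cst.
apply: CkM => //; first exact: Ck_cst.
by apply: Ck_trace => //; apply: Ck_mulmx => //; exact: Ck_trmx.
Qed.

Lemma Ck_inv_sylvester_mx n k (O : set V) (P Q : V -> 'M[R]_n) : open O ->
  (forall x, O x -> posdef (P x)) -> (forall x, O x -> posdef (Q x)) ->
  Ck_on k O P -> Ck_on k O Q ->
  forall i j, Ck_on k O (fun x => invmx (sylvester_mx (P x) (Q x)) i j).
Proof.
move=> oO pP pQ CP CQ; apply/Ck_mxP => //.
apply: Ck_invmx => // [x Ox|]; last exact: Ck_sylvester_mx.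
by apply: sylvester_mx_unit; [exact: pP|exact: pQ].
Qed.

(** With X = P y - P x, where P = [sqrtmx] o G, one has P x X + X P y = G y -
G x, so [sylvester_bound] controls X uniformly in y. *)
Lemma sqrtmx_continuous n (O : set V) (G : V -> 'M[R]_n) : open O ->
  (forall x, O x -> posdef (G x)) -> Ck_on 0 O G ->
  Ck_on 0 O (fun x => sqrtmx (G x)).
Proof.
move=> oO pG CG; apply/Ck_mxP => // i j x Ox.
have [pPx PPx] := sqrtmxP (pG x Ox).
have [c c0 cP] := sylvester_bound pPx.
pose b y := Num.sqrt (c * sqn (G y - G x)).
have Cb : {for x, continuous b}.
  have cc : {for x, continuous (fun y => c * sqn (G y - G x))}.
    exact: (Ck_sqnB c (G x) oO CG) x Ox.
  by apply: continuous_comp cc _; exact: sqrt_continuous.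
have b0 : b x = 0 by rewrite /b subrr sqn0 mulr0 sqrtr0.
rewrite /prop_for /continuous_at; apply/cvgrPdist_lt => e e0.
have : \forall y \near x, `|b x - b y| < e by move: Cb => /cvgrPdist_lt; apply.
have nO : \forall y \near x, O y by exact: open_nbhs_nbhs.
rewrite b0; apply: filterS2 nO => y Oy; rewrite sub0r normrN; apply: le_lt_trans.
have [pPy PPy] := sqrtmxP (pG y Oy).
rewrite [leRHS]ger0_norm ?sqrtr_ge0 // distrC -sqrtr_sqr ler_wsqrtr //.
have := cP _ (sqrtmx (G y) - sqrtmx (G x)) pPy.
rewrite mulmxBr mulmxBl PPx PPy addrCA addrAC subrr add0r.
rewrite [X in c * sqn X]addrC; apply: le_trans.
by have := sqr_le_sqn (sqrtmx (G y) - sqrtmx (G x)) i j; rewrite !mxE.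
Qed.

(** Solving P x X + X P y = G y - G x for X = P y - P x exhibits the
increments of P = [sqrtmx] o G as combinations of increments of the entries of
G, with coefficients continuous in y. The derivative of P is then a
combination of derivatives of G whose coefficients are rational in P, so P is
C^(k+1) as soon as it is C^k and G is C^(k+1). *)
Lemma Ck_sqrtmx n k (O : set V) (G : V -> 'M[R]_n) : open O ->
  (forall x, O x -> posdef (G x)) -> Ck_on k O G ->
  Ck_on k O (fun x => sqrtmx (G x)).
Proof.
move=> oO pG; elim: k => [|k IH]; first exact: sqrtmx_continuous.
move=> CG; have CP := IH (CkS CG).
pose P x := sqrtmx (G x).
have pP x : O x -> posdef (P x) by move=> Ox; exact: (sqrtmxP (pG x Ox)).1.
have PP x : O x -> P x *m P x = G x by move=> Ox; exact: (sqrtmxP (pG x Ox)).2.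
pose g l (x : V) := mxvec (G x) 0 l.
have Cg l : Ck_on k.+1 O (g l) by exact: Ck_mxvec.
apply/Ck_mxP => // i j.
pose c x l y := invmx (sylvester_mx (P x) (P y)) l (mxvec_index i j).
have D x : O x -> differentiable (fun y => P y i j) x /\
    forall v, 'D_v (fun y => P y i j) x = \sum_l c x l x * 'D_v (g l) x.
  move=> Ox; apply: differentiable_cts_sum.
  - move=> l; apply: (@Ck_continuous _ _ _ k O) => //.
    apply: (Ck_inv_sylvester_mx oO (fun _ _ => pP x Ox) pP (Ck_cst k O (P x)) CP).
  - by move=> l; case: (Cg l) => dg _; exact: dg.
  - have nO : \forall y \near x, O y by exact: open_nbhs_nbhs.
    apply: filterS nO => y Oy.
    have S := sylvester_solve (P y - P x) (pP x Ox) (pP y Oy).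
    have -> : \sum_l c x l y * (g l y - g l x) =
        mxvec (P y - P x) 0 (mxvec_index i j).
      rewrite S mulmxBr mulmxBl !PP // addrCA addrAC subrr add0r.
      rewrite [RHS]mxE; apply: eq_bigr => l _.
      rewrite mulrC linearB; congr (_ * _).
      by rewrite [RHS]mxE; congr (_ + _); rewrite [RHS]mxE.
    by rewrite mxvecE 2!mxE addrCA subrr addr0.
split=> [x Ox|v]; first exact: (D x Ox).1.
have Ci := Ck_inv_sylvester_mx oO pP pP CP CP.
have Cs := Ck_sum (index_enum _) oO
  (fun l => CkM oO (Ci l (mxvec_index i j)) ((Cg l).2 v)).
by apply: Ck_ext Cs => // x Ox; rewrite (D x Ox).2.
Qed.

End Posdef.

(** * Polar decomposition and coordinates on D5 *)

Section Polar.
Variable R : realType.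
Local Notation M3 := 'M[R]_3.

Lemma S8P (A : M3) : S8 A <-> sqn A = 3.
Proof.
rewrite /S8 /= /euclid_norm -[mx_inner A A]/(sqn A); split=> [|->//].
by move=> /eqP; rewrite eqr_sqrt ?sqn_ge0 // => /eqP.
Qed.

Lemma orthogonal_unit (U : M3) : O3 U -> U \in unitmx.
Proof. by move=> /mulmx1_unit []. Qed.

Lemma orthogonal_inv (U : M3) : O3 U -> invmx U = U^T.
Proof.
move=> UU; rewrite -[RHS]mulmx1 -(mulmxV (orthogonal_unit UU)) mulmxA.
by rewrite (UU : _ *m _ = _) mul1mx.
Qed.

Lemma det_orthogonal (U : M3) : O3 U -> \det U = 1 \/ \det U = -1.
Proof.
move=> /(congr1 determinant); rewrite det_mulmx det_tr det1 -expr2 => /eqP.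
by rewrite sqrf_eq1 => /orP [] /eqP; [left|right].
Qed.

(** The spectral theorem provides an orthogonal diagonalization; if its
determinant is -1, the sign of the orthogonal matrix is changed, which
reverses the determinant because 3 is odd. *)
Lemma D5P (P : M3) : D5 P <-> posdef P /\ sqn P = 3.
Proof.
split=> [[A [U [[SA dA A0] [OU _] ->]]]|[pP nP]].
  have UU : U^T *m U = 1%:M by [].
  rewrite (orthogonal_inv OU); split; last first.
    by rewrite -mulmxA sqn_mul_orth // sqn_mul_orthr ?trmxK //; exact/S8P.
  have -> : A = diag_mx (\row_i A i i).
    apply/matrixP => i j; rewrite !mxE; have [->|ij] := eqVneq; first by rewrite mulr1n.
    by rewrite mulr0n; apply/eqP; move/is_diag_mxP: dA => /(_ i j ij) ->.
  by apply/posdef_diag => // i; rewrite mxE.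
have [U [d [UU PE d0]]] := posdef_spectral pP.
have UV : U *m U^T = 1%:M by exact: mulmx1C.
have D2d : D2 (diag_mx d).
  split; last by move=> i; rewrite mxE eqxx mulr1n.
    by apply/S8P; rewrite -nP PE -mulmxA sqn_mul_orth // sqn_mul_orthr ?trmxK.
  exact: diag_mx_is_diag.
have [dU|dU] := det_orthogonal UU.
  by exists (diag_mx d), U; split => //; rewrite (orthogonal_inv UU).
have OU : O3 (- U) by rewrite /O3 /= trmxN mulNmx mulmxN opprK.
exists (diag_mx d), (- U); split => //.
  by split=> //; rewrite -scaleN1r detZ dU -exprSr; ring.
by rewrite (orthogonal_inv OU) trmxN !mulNmx mulmxN opprK.
Qed.

Definition polar_pos (A : M3) : M3 := sqrtmx (A^T *m A).
Definition polar_rot (A : M3) : M3 := A *m invmx (polar_pos A).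

Lemma polar_posP (A : M3) : A \in unitmx ->
  posdef (polar_pos A) /\ polar_pos A *m polar_pos A = A^T *m A.
Proof. by move=> uA; apply: sqrtmxP; exact: posdef_gram. Qed.

Lemma polar_rotK (A : M3) : A \in unitmx -> polar_rot A *m polar_pos A = A.
Proof.
by move=> /polar_posP [/posdef_unit uP _]; rewrite /polar_rot mulmxKV.
Qed.

Lemma polar_rot_orthogonal (A : M3) : A \in unitmx -> O3 (polar_rot A).
Proof.
move=> /polar_posP [pP PP]; have uP := posdef_unit pP.
rewrite /O3 /= /polar_rot trmx_mul trmx_inv pP.1 mulmxA -(mulmxA _ A^T) -PP.
by rewrite mulKmx // mulmxV.
Qed.

Lemma sqn_polar_pos (A : M3) : A \in unitmx -> sqn (polar_pos A) = sqn A.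
Proof.
by move=> uA; rewrite -{2}(polar_rotK uA) sqn_mul_orth //; exact: polar_rot_orthogonal.
Qed.

Lemma polar_pos_mul (U P : M3) : O3 U -> posdef P -> polar_pos (U *m P) = P.
Proof.
move=> UU pP; rewrite /polar_pos trmx_mul mulmxA -(mulmxA _ U^T).
by rewrite (UU : _ *m _ = _) mulmx1 pP.1 sqrtmx_sqr.
Qed.

Lemma polar_rot_mul (U P : M3) : O3 U -> posdef P -> polar_rot (U *m P) = U.
Proof. by move=> UU pP; rewrite /polar_rot polar_pos_mul // mulmxK // posdef_unit. Qed.

(** The matrix version of x + sqrt (1 + x^2) = exp (arcsinh x), which is a
bijection from the line onto the positive numbers. It maps the symmetric
matrices onto the positive definite ones. *)
Definition hyperbolic_chart (S : M3) : M3 := S + sqrtmx (1%:M + S *m S).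

(** The coordinates of the cell D5: a symmetric matrix of trace 0 is sent to
the point of the sphere on the ray of its [hyperbolic_chart]. *)
Definition cell_param (S : M3) : M3 :=
  (Num.sqrt 3 / Num.sqrt (sqn (hyperbolic_chart S))) *: hyperbolic_chart S.

(** The inverse of [cell_param]: [c] is the factor for which P = c Q and its
inverse have the same trace, which makes (P - P^-1) / 2 traceless. *)
Definition cell_coord (Q : M3) : M3 :=
  let c := Num.sqrt (\tr (invmx Q) / \tr Q) in
  2^-1 *: (c *: Q - c^-1 *: invmx Q).

Lemma hyperbolic_chart_posdef (S : M3) : S^T = S -> posdef (hyperbolic_chart S).
Proof.
move=> /spectral_theorem [U [d [UU ->]]].
have UV : U *m U^T = 1%:M by exact: mulmx1C.
pose e : 'rV[R]_3 := \row_i Num.sqrt (1 + d 0 i ^+ 2).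
have e0 i : 0 < e 0 i.
  by rewrite mxE sqrtr_gt0 ltr_pwDl // sqr_ge0.
have ee : (U *m diag_mx e *m U^T) *m (U *m diag_mx e *m U^T) =
    1%:M + (U *m diag_mx d *m U^T) *m (U *m diag_mx d *m U^T).
  have sq a : (U *m diag_mx a *m U^T) *m (U *m diag_mx a *m U^T) =
      U *m diag_mx (\row_i (a 0 i * a 0 i)) *m U^T.
    by rewrite !mulmxA -(mulmxA _ U^T U) UU mulmx1 -(mulmxA U) mulmx_diag.
  have <- : U *m diag_mx (const_mx 1) *m U^T = 1%:M by rewrite diag_const_mx mulmx1.
  rewrite !sq -mulmxDl -mulmxDr -linearD /=.
  congr (_ *m (diag_mx _) *m _); apply/rowP => i; rewrite !mxE.
  by rewrite -expr2 sqr_sqrtr // addr_ge0 // sqr_ge0.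
rewrite /hyperbolic_chart -ee sqrtmx_sqr; last exact/posdef_diag.
rewrite -mulmxDl -mulmxDr -linearD /=; apply/posdef_diag => // i.
rewrite 2!mxE -ltrBlDl sub0r; apply: le_lt_trans (ler_norm _) _.
by rewrite normrN -sqrtr_sqr ltr_sqrt ?ltrDr // ltr_pwDl // sqr_ge0.
Qed.

(** In a common eigenbasis this is (s + sqrt (1 + s^2)) (sqrt (1 + s^2) - s) =
1. The two factors commute, since the commutator of S with the root R of 1 +
S^2 is annihilated by the Sylvester operator of R. *)
Lemma hyperbolic_chart_inv (S : M3) : S^T = S ->
  invmx (hyperbolic_chart S) = sqrtmx (1%:M + S *m S) - S.
Proof.
move=> ST; have uh := posdef_unit (hyperbolic_chart_posdef ST).
have [pR RR] := sqrtmxP (posdef_1Dsqr ST).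
rewrite -[RHS](mulKmx uh) /hyperbolic_chart.
set T := sqrtmx _ in pR RR *.
have ST_comm : T *m S - S *m T = 0.
  apply: (sylvester_inj pR pR); rewrite mulmxBr mulmxBl !mulmxA RR addrA subrK.
  by rewrite -mulmxA RR mulmxDl mulmxDr mul1mx mulmx1 mulmxA subrr.
have -> : (S + T) *m (T - S) = 1%:M; last by rewrite mulmx1.
rewrite mulmxDl !mulmxBr RR (subr0_eq ST_comm).
by move: (S *m S) (S *m T) => a b; apply/matrixP => i j; rewrite !mxE; ring.
Qed.

Lemma cell_param_D5 (S : M3) : S^T = S -> D5 (cell_param S).
Proof.
move=> /hyperbolic_chart_posdef ph.
have h0 := posdef_sqn_gt0 ph.
apply/D5P; split; first by apply: posdefZ => //; rewrite divr_gt0 ?sqrtr_gt0.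
by rewrite sqnZ exprMn exprVn !sqr_sqrtr ?(ltW h0) // mulfVK // gt_eqF.
Qed.

Lemma hyperbolic_chart0 : hyperbolic_chart 0 = 1%:M.
Proof.
rewrite /hyperbolic_chart add0r mulmx0 addr0 -{1}(mulmx1 1%:M).
by rewrite sqrtmx_sqr //; exact: posdef1.
Qed.

Lemma sqn1 : sqn (1%:M : M3) = 3.
Proof. by rewrite /sqn trmx1 mulmx1 mxtrace1. Qed.

Lemma cell_param0 : cell_param 0 = 1%:M.
Proof.
by rewrite /cell_param hyperbolic_chart0 sqn1 divff ?scale1r // gt_eqF // sqrtr_gt0.
Qed.

Lemma invmxZ_posdef (k : R) (Q : M3) : 0 < k -> posdef Q ->
  invmx (k *: Q) = k^-1 *: invmx Q.
Proof.
by move=> k0 pQ; rewrite invmxZ // unitmxZ ?unitfE ?gt_eqF ?posdef_unit.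
Qed.

Section Ratio.
Variable Q : M3.
Hypothesis pQ : posdef Q.

Let tQ : 0 < \tr Q := posdef_mxtrace_gt0 pQ.
Let tV : 0 < \tr (invmx Q) := posdef_mxtrace_gt0 (posdef_inv pQ).
Let c := Num.sqrt (\tr (invmx Q) / \tr Q).
Let c0 : 0 < c. Proof. by rewrite sqrtr_gt0 divr_gt0. Qed.

Lemma cell_coord_sym : (cell_coord Q)^T = cell_coord Q.
Proof. by rewrite /cell_coord trmxZ trmxB !trmxZ trmx_inv pQ.1. Qed.

Lemma cell_coord_trace0 : \tr (cell_coord Q) = 0.
Proof.
rewrite /cell_coord -/c mxtraceZ mxtraceB !mxtraceZ.
have : c ^+ 2 * \tr Q = \tr (invmx Q).
  by rewrite sqr_sqrtr ?divfK ?gt_eqF // ltW // divr_gt0.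
by move=> <-; rewrite expr2 -(mulrA c) mulKf ?gt_eqF // subrr mulr0.
Qed.

(** If S = (P - P^-1) / 2 then 1 + S^2 is the square of (P + P^-1) / 2, which
is positive definite, so the chart takes S back to P. *)
Lemma hyperbolic_chart_coord : hyperbolic_chart (cell_coord Q) = c *: Q.
Proof.
have uQ := posdef_unit pQ.
pose T := 2^-1 *: (c *: Q + c^-1 *: invmx Q).
have pT : posdef T.
  apply: posdefZ; first by rewrite invr_gt0.
  by apply: posdefD; apply: posdefZ; rewrite ?invr_gt0 //; exact: posdef_inv.
have TT : 1%:M + cell_coord Q *m cell_coord Q = T *m T.
  rewrite /cell_coord /T -/c -!scalemxAl -!scalemxAr !scalerA.
  rewrite !mulmxDl !mulmxDr !mulNmx !mulmxN -!scalemxAl -!scalemxAr !scalerA.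
  rewrite mulmxV // mulVmx // mulfV ?gt_eqF // mulVf ?gt_eqF // scale1r.
  rewrite opprK; move: (Q *m Q) (invmx Q *m invmx Q) => a b.
  by apply/matrixP => i j; rewrite !mxE; field; rewrite gt_eqF.
rewrite /hyperbolic_chart TT sqrtmx_sqr // /T /cell_coord -/c.
by apply/matrixP => i j; rewrite !mxE; field; rewrite gt_eqF.
Qed.

Lemma cell_coordK : sqn Q = 3 -> cell_param (cell_coord Q) = Q.
Proof.
move=> nQ; rewrite /cell_param hyperbolic_chart_coord sqnZ nQ sqrtrM ?sqr_ge0 //.
rewrite sqrtr_sqr gtr0_norm // scalerA -[RHS]scale1r; congr (_ *: _).
have s3 : Num.sqrt 3 != 0 :> R by rewrite gt_eqF // sqrtr_gt0.
by field; rewrite s3 gt_eqF.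
Qed.

Lemma cell_coordZ k : 0 < k -> cell_coord (k *: Q) = cell_coord Q.
Proof.
move=> k0; rewrite /cell_coord invmxZ_posdef // !mxtraceZ.
have -> : k^-1 * \tr (invmx Q) / (k * \tr Q) =
    k^-1 ^+ 2 * (\tr (invmx Q) / \tr Q) by field; rewrite !gt_eqF.
rewrite sqrtrM ?sqr_ge0 // sqrtr_sqr gtr0_norm ?invr_gt0 // -/c !scalerA.
by rewrite mulrAC mulVf ?gt_eqF // mul1r invfM invrK mulrAC mulfV ?gt_eqF // mul1r.
Qed.

End Ratio.

Lemma cell_paramK (S : M3) : S^T = S -> \tr S = 0 -> cell_coord (cell_param S) = S.
Proof.
move=> ST tS; have ph := hyperbolic_chart_posdef ST.
have h0 := posdef_sqn_gt0 ph.
rewrite /cell_param cell_coordZ // ?divr_gt0 ?sqrtr_gt0 // /cell_coord hyperbolic_chart_inv //.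
have -> : \tr (sqrtmx (1%:M + S *m S) - S) = \tr (hyperbolic_chart S).
  by rewrite mxtraceB tS subr0 /hyperbolic_chart mxtraceD tS add0r.
rewrite divff ?gt_eqF ?posdef_mxtrace_gt0 // sqrtr1 invr1 !scale1r /hyperbolic_chart.
by apply/matrixP => i j; rewrite !mxE; field.
Qed.

End Polar.

(** * Derivatives of matrix-valued curves *)

Section MatrixCurves.
Variables (R : realType) (V : normedModType R).
Implicit Types (x v : V).

Lemma is_derive_mxP m n (F : V -> 'M[R]_(m, n)) x v D :
  is_derive x v F D <-> forall i j, is_derive x v (fun y => F y i j) (D i j).
Proof.
split=> [dF i j|dF].
  have dF1 : derivable F x v by case: dF.
  apply: DeriveDef; first exact: (derivable_mxP F x v).1.
  by have := @derive_val _ _ _ _ _ _ _ dF; rewrite derive_mx // => <-; rewrite mxE.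
have dF1 : derivable F x v by apply/derivable_mxP => i j; case: (dF i j).
apply: DeriveDef => //; rewrite derive_mx //; apply/matrixP => i j; rewrite mxE.
exact: (@derive_val _ _ _ _ _ _ _ (dF i j)).
Qed.

Lemma is_derive_bigsum (I : Type) (r : seq I) (f : I -> V -> R) x v d :
  (forall i, is_derive x v (f i) (d i)) ->
  is_derive x v (fun y => \sum_(i <- r) f i y) (\sum_(i <- r) d i).
Proof.
move=> df; elim: r => [|i r IH].
  rewrite big_nil; under eq_fun do rewrite big_nil; exact: is_derive_cst.
by rewrite big_cons; under eq_fun do rewrite big_cons; exact: is_deriveD.
Qed.

Lemma is_derive_mulmx m n p (F : V -> 'M[R]_(m, n)) (G : V -> 'M[R]_(n, p))
    x v dF dG : is_derive x v F dF -> is_derive x v G dG ->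
  is_derive x v (fun y => F y *m G y) (dF *m G x + F x *m dG).
Proof.
move=> /is_derive_mxP HF /is_derive_mxP HG; apply/is_derive_mxP => i j.
under eq_fun do rewrite mxE.
rewrite !mxE -big_split /=; apply: is_derive_bigsum => k.
have HM := @is_deriveM _ _ _ _ _ _ _ _ (HF i k) (HG k j).
apply: (is_derive_eq HM); rewrite addrC; congr (_ + _).
by rewrite -[LHS]/(_ * _) mulrC.
Qed.

Lemma is_derive_trmx m n (F : V -> 'M[R]_(m, n)) x v D :
  is_derive x v F D -> is_derive x v (fun y => (F y)^T) D^T.
Proof.
move=> /is_derive_mxP HF; apply/is_derive_mxP => i j; rewrite mxE.
by under eq_fun do rewrite mxE; exact: HF.
Qed.

Lemma is_derive_mxtrace n (F : V -> 'M[R]_n) x v D :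
  is_derive x v F D -> is_derive x v (fun y => \tr (F y)) (\tr D).
Proof. by move=> /is_derive_mxP HF; apply: is_derive_bigsum => i. Qed.

Lemma is_derive_sqn m n (F : V -> 'M[R]_(m, n)) x v D :
  is_derive x v F D ->
  is_derive x v (fun y => sqn (F y)) (2 * \tr ((F x)^T *m D)).
Proof.
move=> HF; have := is_derive_mxtrace (is_derive_mulmx (is_derive_trmx HF) HF).
by move/is_derive_eq; apply; rewrite mxtraceD (mxtrace_tr_mul _ D); ring.
Qed.

Lemma is_derive_scalemx m n (s : V -> R) (F : V -> 'M[R]_(m, n)) x v ds D :
  is_derive x v s ds -> is_derive x v F D ->
  is_derive x v (fun y => s y *: F y) (ds *: F x + s x *: D).
Proof.
move=> Hs /is_derive_mxP HF; apply/is_derive_mxP => i j.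
under eq_fun do rewrite mxE.
apply: (is_derive_eq (@is_deriveM _ _ _ _ _ _ _ _ Hs (HF i j))).
rewrite !mxE [LHS]addrC; congr (_ + _).
by rewrite -[LHS]/(_ * _) mulrC.
Qed.

Lemma is_derive_cst_unique (W : normedModType R) (f : V -> W) x v d (a : W) :
  (forall y, f y = a) -> is_derive x v f d -> d = 0.
Proof.
move=> fa df; have fE : f = cst a by apply/funext.
by rewrite -(@derive_val _ _ _ _ _ _ _ df) fE derive_cst.
Qed.

Lemma Ck_is_derive (W : normedModType R) (O : set V) (f : V -> W) x v :
  (forall k, Ck_on k O f) -> O x -> is_derive x v f ('D_v f x).
Proof. by move=> /(_ 1%N) [df _] Ox; apply: DeriveDef => //; exact/diff_derivable/df. Qed.

End MatrixCurves.

(** For a curve of the form w0 + t w(t) the difference quotient at 0 is w(t):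
a velocity is computed without differentiating w. *)
Lemma is_derive_secant (R : realType) (W : normedModType R) (w0 : W) (w : R -> W) :
  {for 0, continuous w} -> is_derive (0 : R) (1 : R) (fun t => w0 + t *: w t) (w 0).
Proof.
move=> cw.
have cvgw : (fun h : R => h^-1 *:
   (((fun t => w0 + t *: w t) \o shift 0) (h *: 1) - (w0 + 0 *: w 0))) @ 0^' --> w 0.
  have cw' : w @ 0^' --> w 0 by apply: cvg_trans cw; apply: cvg_fmap2; exact: cvg_within.
  apply: cvg_trans cw'; apply: near_eq_cvg.
  near=> h; have h0 : h != 0 by near: h; exact: nbhs_dnbhs_neq.
  rewrite /= addr0 [h *: 1]mulr1 scale0r addr0 addrC addKr scalerA mulVf //.
  by rewrite scale1r.
apply: DeriveDef; first by apply/cvg_ex; exists (w 0).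
exact: cvg_lim cvgw.
Unshelve. all: by end_near. Qed.

(** * Smoothness of the polar factors and of the coordinates *)

Section Charts.
Variables (R : realType) (V : normedModType R) (k : nat) (O : set V).
Local Notation M3 := 'M[R]_3.
Hypothesis oO : open O.

Lemma Ck_sqn n m (F : V -> 'M[R]_(m, n)) : Ck_on k O F ->
  Ck_on k O (fun x => sqn (F x)).
Proof. by move=> CF; apply: Ck_trace => //; apply: Ck_mulmx => //; exact: Ck_trmx. Qed.

Lemma Ck_polar_pos (F : V -> M3) : (forall x, O x -> F x \in unitmx) ->
  Ck_on k O F -> Ck_on k O (fun x => polar_pos (F x)).
Proof.
move=> uF CF; apply: Ck_sqrtmx => // [x Ox|]; first exact/posdef_gram/uF.
by apply: Ck_mulmx => //; exact: Ck_trmx.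
Qed.

Lemma Ck_polar_rot (F : V -> M3) : (forall x, O x -> F x \in unitmx) ->
  Ck_on k O F -> Ck_on k O (fun x => polar_rot (F x)).
Proof.
move=> uF CF; apply: Ck_mulmx => //; apply: Ck_invmx => // [x Ox|].
  exact: posdef_unit (polar_posP (uF x Ox)).1.
exact: Ck_polar_pos.
Qed.

Lemma Ck_hyperbolic_chart (S : V -> M3) : (forall x, O x -> (S x)^T = S x) ->
  Ck_on k O S -> Ck_on k O (fun x => hyperbolic_chart (S x)).
Proof.
move=> ST CS; apply: CkD => //; apply: Ck_sqrtmx => // [x Ox|].
  exact/posdef_1Dsqr/ST.
by apply: CkD => //; [exact: Ck_cst|exact: Ck_mulmx].
Qed.

Lemma Ck_cell_param (S : V -> M3) : (forall x, O x -> (S x)^T = S x) ->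
  Ck_on k O S -> Ck_on k O (fun x => cell_param (S x)).
Proof.
move=> ST CS; have Ch := Ck_hyperbolic_chart ST CS.
have h0 x : O x -> 0 < sqn (hyperbolic_chart (S x)).
  by move=> /ST /hyperbolic_chart_posdef /posdef_sqn_gt0.
apply: Ck_scale => //; apply: CkM => //; first exact: Ck_cst.
apply: CkV => // [x Ox|]; first by rewrite gt_eqF // sqrtr_gt0 h0.
by apply: Ck_sqrt => //; exact: Ck_sqn.
Qed.

Lemma Ck_cell_coord (Q : V -> M3) : (forall x, O x -> posdef (Q x)) ->
  Ck_on k O Q -> Ck_on k O (fun x => cell_coord (Q x)).
Proof.
move=> pQ CQ.
have CV : Ck_on k O (fun x => invmx (Q x)).
  by apply: Ck_invmx => // x Ox; exact/posdef_unit/pQ.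
have tQ x : O x -> 0 < \tr (Q x) by move=> /pQ; exact: posdef_mxtrace_gt0.
have r0 x : O x -> 0 < \tr (invmx (Q x)) / \tr (Q x).
  by move=> Ox; rewrite divr_gt0 ?tQ // posdef_mxtrace_gt0 //; exact/posdef_inv/pQ.
have Cc : Ck_on k O (fun x => Num.sqrt (\tr (invmx (Q x)) / \tr (Q x))).
  apply: Ck_sqrt => //; apply: CkM => //; first exact: Ck_trace.
  apply: CkV => // [x Ox|]; first by rewrite gt_eqF // tQ.
  exact: Ck_trace.
have CcV : Ck_on k O (fun x => (Num.sqrt (\tr (invmx (Q x)) / \tr (Q x)))^-1).
  by apply: CkV => // x Ox; rewrite gt_eqF // sqrtr_gt0 r0.
have CN : Ck_on k O (fun x => (-1 : R) *:
    ((Num.sqrt (\tr (invmx (Q x)) / \tr (Q x)))^-1 *: invmx (Q x))).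
  by apply: Ck_scale => //; [exact: Ck_cst|exact: Ck_scale].
have C := Ck_scale oO (Ck_cst k O (2^-1 : R)) (CkD oO (Ck_scale oO Cc CQ) CN).
by apply: Ck_ext C => // x _; rewrite scaleN1r.
Qed.

End Charts.

Section ParamDerivative.
Variable R : realType.
Local Notation M3 := 'M[R]_3.

(** The root R(t) of 1 + t^2 S^2 has R(0) = 1 and R(t)^2 has derivative 0 at
0, so R has derivative 0. The scaling factor s(t) satisfies s(t)^2 |h(t)|^2 =
3 for the chart h(t) = t S + R(t), and |h|^2 has derivative 2 tr S = 0 at 0,
so s has derivative 0 as well. *)
Lemma is_derive_cell_param0 (S : M3) : S^T = S -> \tr S = 0 ->
  is_derive (0 : R) (1 : R) (fun t => cell_param (t *: S)) S.
Proof.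
move=> ST tS.
have tST (t : R) : (t *: S)^T = t *: S by rewrite trmxZ ST.
have CT k : Ck_on k setT (fun t : R => t *: S).
  by apply: Ck_scale; [exact: openT|exact: Ck_id|exact: Ck_cst].
have dT : is_derive (0 : R) (1 : R) (fun t : R => t *: S) S.
  have := is_derive_scalemx (is_derive_id (0 : R) (1 : R)) (is_derive_cst S (0 : R) (1 : R)).
  by move/is_derive_eq; apply; rewrite scale1r scaler0 addr0.
pose G t := 1%:M + (t *: S) *m (t *: S).
have pG t : posdef (G t) by apply: posdef_1Dsqr.
have CG k : Ck_on k setT G.
  apply: CkD; [exact: openT|exact: Ck_cst|].
  by apply: Ck_mulmx => //; exact: openT.
have CT' k : Ck_on k setT (fun t => sqrtmx (G t)).
  by apply: Ck_sqrtmx => // ; exact: openT.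
pose r t := sqrtmx (G t).
have r0 : r 0 = 1%:M.
  by rewrite /r /G scale0r mulmx0 addr0 -{1}(mulmx1 1%:M) sqrtmx_sqr //; exact: posdef1.
have dr : is_derive (0 : R) (1 : R) r 0.
  have D := Ck_is_derive (1 : R) CT' (I : setT 0).
  have D2 := is_derive_mulmx D D.
  have DG : is_derive (0 : R) (1 : R) G 0.
    have := is_deriveD (is_derive_cst (1%:M : M3) (0 : R) (1 : R)) (is_derive_mulmx dT dT).
    by move/is_derive_eq; apply; rewrite scale0r mulmx0 mul0mx !addr0.
  have E : (fun y => sqrtmx (G y) *m sqrtmx (G y)) = G.
    by apply/funext => y; exact: (sqrtmxP (pG y)).2.
  rewrite E in D2.
  have := @derive_val _ _ _ _ _ _ _ D2; rewrite (@derive_val _ _ _ _ _ _ _ DG).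
  rewrite -[sqrtmx (G 0)]/(r 0) r0 mulmx1 mul1mx => /esym/eqP.
  rewrite -mulr2n -scaler_nat scaler_eq0 pnatr_eq0 /= => /eqP d0.
  by rewrite -d0.
have dh : is_derive (0 : R) (1 : R) (fun t => hyperbolic_chart (t *: S)) S.
  by have := is_deriveD dT dr; move/is_derive_eq; apply; rewrite addr0.
have h0 : hyperbolic_chart (0 *: S) = 1%:M by rewrite scale0r hyperbolic_chart0.
pose s t := Num.sqrt 3 / Num.sqrt (sqn (hyperbolic_chart (t *: S))).
have n0 t : 0 < sqn (hyperbolic_chart (t *: S)).
  exact/posdef_sqn_gt0/hyperbolic_chart_posdef.
have Cs k : Ck_on k setT s.
  apply: CkM; [exact: openT|exact: Ck_cst|]; apply: CkV; first exact: openT.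
    by move=> t _; rewrite gt_eqF // sqrtr_gt0.
  apply: Ck_sqrt => //; first exact: openT.
  apply: Ck_sqn; first exact: openT.
  by apply: Ck_hyperbolic_chart => //; exact: openT.
have s0 : s 0 = 1 by rewrite /s h0 sqn1 divff // gt_eqF // sqrtr_gt0.
have ds : is_derive (0 : R) (1 : R) s 0.
  have D := Ck_is_derive (1 : R) Cs (I : setT 0).
  have Dn := is_derive_sqn dh.
  have D3 := is_deriveM (is_deriveM D D) Dn.
  suff d0 : 'D_1 s 0 = 0 by rewrite d0 in D.
  have := is_derive_cst_unique _ D3 => /(_ 3).
  rewrite !fctE h0 trmx1 mul1mx tS mulr0 sqn1 s0 scaler0 add0r !scale1r => H.
  have : (3 : R) *: ('D_1 s 0 + 'D_1 s 0) = 0.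
    apply: H => t; rewrite /s -expr2 exprMn exprVn !sqr_sqrtr ?(ltW (n0 _)) //.
    by rewrite mulfVK // gt_eqF.
  rewrite -[_ *: _]/(_ * _) => /eqP; rewrite mulf_eq0 pnatr_eq0 /= => /eqP; lra.
have := is_derive_scalemx ds dh.
by move/is_derive_eq; apply; rewrite scale0r add0r s0 scale1r.
Qed.
End ParamDerivative.

(** * Normal spaces of the orthogonal components in the sphere *)

Section NormalFiber.
Variable R : realType.
Local Notation M3 := 'M[R]_3.

Definition orthogonal_det (e : R) : set M3 := [set U | O3 U /\ \det U = e].

Lemma tangent_S8 (A X : M3) : tangent_space S8 A X -> \tr (A^T *m X) = 0.
Proof.
move=> [c [cS c0 dc]]; have D := is_derive_sqn dc.
have := is_derive_cst_unique (fun t => (S8P (c t)).1 (cS t)) D.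
by rewrite c0 => /eqP; rewrite mulf_eq0 pnatr_eq0 /= => /eqP.
Qed.

(** Differentiate c(t)^T c(t) = 1. *)
Lemma tangent_orthogonal_det e (U Y : M3) : tangent_space (orthogonal_det e) U Y ->
  (U^T *m Y)^T = - (U^T *m Y).
Proof.
move=> [c [cO c0 dc]].
have D := is_derive_mulmx (is_derive_trmx dc) dc.
have := is_derive_cst_unique (fun t => (cO t).1 : _ = 1%:M) D.
by rewrite c0 => /eqP; rewrite addr_eq0 trmx_mul trmxK => /eqP.
Qed.

Lemma tangent_S8_sub (A X : M3) : S8 A -> \tr (A^T *m X) = 0 ->
  tangent_space S8 A X.
Proof.
move=> /S8P nA AX.
(* The circle through A with velocity X, parametrized rationally:
   ((3 - y) A + 3 t X) / (3 + y) with y = |X|^2 t^2 / 4. *)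
have [x xE] : exists x, x = sqn X by eexists.
have x0 : 0 <= x by rewrite xE sqn_ge0.
pose q (t : R) := x / 4 * t ^+ 2.
have q0 t : 0 <= q t by rewrite mulr_ge0 ?sqr_ge0 // divr_ge0.
have h12 t : 12 + x * t ^+ 2 != 0.
  by rewrite gt_eqF // ltr_pwDl // mulr_ge0 // sqr_ge0.
have q3 t : 3 + q t != 0 by rewrite gt_eqF // ltr_pwDl.
pose w (t : R) : M3 := (3 + q t)^-1 *: ((- (x / 2) * t) *: A + 3 *: X).
have Cw k : Ck_on k setT w.
  apply: Ck_scale; first exact: openT.
    apply: CkV; [exact: openT|by move=> t _|].
    apply: CkD; [exact: openT|exact: Ck_cst|].
    apply: CkM; [exact: openT|exact: Ck_cst|].
    by apply: CkM; [exact: openT|exact: Ck_id|exact: Ck_id].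
  apply: CkD; [exact: openT| |exact: Ck_cst].
  apply: Ck_scale; [exact: openT| |exact: Ck_cst].
  by apply: CkM; [exact: openT|exact: Ck_cst|exact: Ck_id].
exists (fun t => A + t *: w t); split=> [t||].
- apply/S8P; have -> : A + t *: w t =
      (3 + q t)^-1 *: ((3 - q t) *: A - (- (3 * t)) *: X).
    by apply/matrixP => i j; rewrite /w /q !mxE; field; exact: h12.
  rewrite sqnZ sqnB !sqnZ trmxZ -scalemxAl -scalemxAr !mxtraceZ AX nA -xE /q.
  by field; exact: h12.
- by rewrite scale0r addr0.
- have := is_derive_secant A (Ck_smooth_continuous (x := 0) Cw).
  move/is_derive_eq; apply.
  by rewrite /w /q expr0n !mulr0 scale0r add0r addr0 scalerA mulVf // scale1r.
Qed.

Section Rotation.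
Variable K : M3.
Hypotheses (KT : K^T = - K) (K3 : K *m K *m K = - K).

(** The Cayley transform (1 - t K)^-1 (1 + t K), expanded by means of K^3 = -
K. *)
Definition rotation (t : R) : M3 :=
  1%:M + (2 * t / (1 + t ^+ 2)) *: K + (2 * t ^+ 2 / (1 + t ^+ 2)) *: (K *m K).

Let t1 (t : R) : 1 + t ^+ 2 != 0.
Proof. by rewrite gt_eqF // ltr_pwDl // sqr_ge0. Qed.

Lemma mul_span_rotation (a b c a' b' c' : R) :
  (a *: 1%:M + b *: K + c *: (K *m K)) *m (a' *: 1%:M + b' *: K + c' *: (K *m K)) =
  (a * a') *: 1%:M + (a * b' + b * a' - b * c' - c * b') *: K +
  (a * c' + b * b' + c * a' - c * c') *: (K *m K).
Proof.
(* The powers of K from the third on reduce to K and K^2. *)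
have K4 : K *m K *m K *m K = - (K *m K) by rewrite K3 mulNmx.
rewrite !mulmxDl !mulmxDr -!scalemxAl -!scalemxAr !mul1mx !mulmx1 !mulmxA K4 K3.
by move: (K *m K) => L; apply/matrixP => i j; rewrite !mxE; ring.
Qed.

Lemma rotation_orthogonal t : O3 (rotation t).
Proof.
rewrite /O3 /= /rotation !trmxD trmx1 !trmxZ trmx_mul KT mulNmx mulmxN opprK.
rewrite -[1%:M]scale1r scalerN -scaleNr mul_span_rotation.
rewrite mulr1 [X in _ + X *: K + _](_ : _ = 0); last by have := t1 t => h; field.
rewrite [X in _ + X *: (K *m K)](_ : _ = 0); last by have := t1 t => h; field.
by rewrite !scale0r !addr0.
Qed.

(** Since (1 - t K) R = 1 + t K is the transpose of 1 - t K, the determinant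
of R is 1. *)
Lemma det_rotation t : \det (rotation t) = 1.
Proof.
have h := t1 t.
pose C (a b c : R) := a *: 1%:M + b *: K + c *: (K *m K).
have u : \det (C 1 (- t) 0) != 0.
  have : C 1 (- t) 0 *m C 1 (t / (1 + t ^+ 2)) (t ^+ 2 / (1 + t ^+ 2)) = 1%:M.
    rewrite mul_span_rotation -[RHS]scale1r mulr1 [X in _ + X *: K + _](_ : _ = 0); last by field.
    rewrite [X in _ + X *: (K *m K)](_ : _ = 0); last by field.
    by rewrite !scale0r !addr0.
  by move=> /mulmx1_unit []; rewrite unitmxE unitfE.
have E : C 1 (- t) 0 *m rotation t = C 1 t 0.
  rewrite /rotation -[X in X + _ + _]scale1r mul_span_rotation /C mulr1.
  by congr (_ + _ *: _ + _ *: _); field.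
have T : C 1 t 0 = (C 1 (- t) 0)^T.
  by rewrite /C !trmxD !trmxZ trmx1 trmx_mul KT scalerN scaleNr opprK !scale0r.
apply: (mulfI u); rewrite mulr1 -{2}det_tr -T -E det_mulmx //.
Qed.

Lemma tangent_rotation e (U : M3) : orthogonal_det e U ->
  tangent_space (orthogonal_det e) U (2 *: (U *m K)).
Proof.
move=> [OU dU].
pose w (t : R) : M3 := (1 + t ^+ 2)^-1 *: (2 *: (U *m K) + (2 * t) *: (U *m (K *m K))).
have Cw k : Ck_on k setT w.
  apply: Ck_scale; first exact: openT.
    apply: CkV; [exact: openT|by move=> t _|].
    apply: CkD; [exact: openT|exact: Ck_cst|].
    by apply: CkM; [exact: openT|exact: Ck_id|exact: Ck_id].
  apply: CkD; [exact: openT|exact: Ck_cst|].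
  apply: Ck_scale; [exact: openT| |exact: Ck_cst].
  by apply: CkM; [exact: openT|exact: Ck_cst|exact: Ck_id].
exists (fun t => U + t *: w t); split=> [t||].
- have -> : U + t *: w t = U *m rotation t.
    rewrite /rotation !mulmxDr mulmx1 -!scalemxAr /w.
    move: (U *m K) (U *m (K *m K)) => a b.
    by apply/matrixP => i j; rewrite !mxE; have h := t1 t; field.
  split; last by rewrite det_mulmx det_rotation mulr1.
  rewrite /O3 /= trmx_mul mulmxA -(mulmxA _ U^T) (OU : _ *m _ = _) mulmx1.
  exact: rotation_orthogonal.
- by rewrite scale0r addr0.
- have := is_derive_secant U (Ck_smooth_continuous (x := 0) Cw).
  move/is_derive_eq; apply.
  by rewrite /w expr0n addr0 invr1 mulr0 scale0r addr0 scale1r.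
Qed.
End Rotation.

Lemma delta_skew_cubed (i j : 'I_3) : i != j ->
  let K : M3 := delta_mx i j - delta_mx j i in
  K^T = - K /\ K *m K *m K = - K.
Proof.
move=> ij K; have ji : j != i by rewrite eq_sym.
have KT : K^T = - K by rewrite trmxB !trmx_delta opprB.
split=> //.
rewrite /K !mulmxBl !mulmxBr !mulmxBl.
rewrite !mul_delta_mx_cond (negPf ij) (negPf ji) !eqxx !mulr0n !mulr1n.
rewrite ?sub0r ?subr0 ?mul0mx ?mulNmx !mul_delta_mx_cond ?(negPf ij) ?(negPf ji) ?eqxx ?mulr0n ?mulr1n.
by rewrite ?sub0r ?subr0 ?oppr0 ?addr0 ?add0r ?opprK ?opprB // addrC.
Qed.

(** Testing orthogonality against the velocities 2 U K of the rotation curves,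
with K = E_ij - E_ji, shows that U^T X is symmetric, and tangency to the
sphere says that its trace is 0. Conversely symmetric and skew matrices are
orthogonal. *)
Lemma normal_fiberP e (U X : M3) : orthogonal_det e U ->
  normal_fiber S8 (orthogonal_det e) U X <->
  (U^T *m X)^T = U^T *m X /\ \tr (U^T *m X) = 0.
Proof.
move=> OU; have SU : S8 U.
  by apply/S8P; rewrite -(mulmx1 U) sqn_mul_orth ?sqn1 //; exact: OU.1.
split=> [[TX nX]|[sX tX]].
  split; last exact: tangent_S8.
  apply/matrixP => i j; rewrite [LHS]mxE.
  have [->//|ij] := eqVneq i j.
  have [KT K3] := delta_skew_cubed ij.
  have := nX _ (tangent_rotation KT K3 OU).
  rewrite /mx_inner -scalemxAr mxtraceZ => /eqP; rewrite mulf_eq0 pnatr_eq0 /=.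
  rewrite mulmxA -[X^T *m U]trmxK trmx_mul trmxK mulmxBr mxtraceB.
  have tr_delta (M : M3) a b : \tr (M *m delta_mx a b) = M b a.
    rewrite /mxtrace (bigD1 b) //= big1 => [|c cb].
      rewrite addr0 mxE (bigD1 a) //= mxE !eqxx mulr1 big1 ?addr0 // => d da.
      by rewrite mxE (negPf da) mulr0.
    by rewrite mxE big1 // => d _; rewrite mxE (negPf cb) andbF mulr0.
  by rewrite !tr_delta !(mxE trmx_key) subr_eq0 => /eqP ->.
split; first exact: tangent_S8_sub.
move=> Y /tangent_orthogonal_det sY; rewrite /mx_inner.
have XU : X = U *m (U^T *m X).
  by rewrite mulmxA (mulmx1C (OU.1 : _ *m _ = _)) mul1mx.
rewrite XU trmx_mul sX -mulmxA; set S := U^T *m X in sX *.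
have : \tr (S *m (U^T *m Y)) = - \tr (S *m (U^T *m Y)).
  by rewrite -{1}mxtrace_tr trmx_mul sY sX mulNmx linearN /= mxtrace_mulC.
by move=> /eqP; rewrite -addr_eq0 -mulr2n mulrn_eq0 /= => /eqP.
Qed.

End NormalFiber.

(** * The tubular neighborhoods *)

Lemma set_bij_inverse (T U : Type) (A : set T) (B : set U) (f : T -> U) (g : U -> T) :
  (forall x, A x -> B (f x)) -> (forall y, B y -> A (g y)) ->
  (forall x, A x -> g (f x) = x) -> (forall y, B y -> f (g y) = y) ->
  set_bij A B f.
Proof.
move=> fAB gBA fK gK; split=> [x Ax|x y /set_mem Ax /set_mem Ay fxy|y By].
- exact: fAB.
- by rewrite -(fK x Ax) fxy fK.
- by exists (g y); [exact: gBA|exact: gK].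
Qed.

Lemma continuous_within (T U : topologicalType) (A : set T) (f : T -> U) :
  (forall x, A x -> {for x, continuous f}) -> {within A, continuous f}.
Proof. by move=> cf; apply: continuous_in_subspaceT => x /set_mem /cf. Qed.

Section Tube.
Variable R : realType.
Local Notation M3 := 'M[R]_3.

Lemma det_continuous : continuous (fun A : M3 => \det A).
Proof.
move=> A; apply: (@Ck_smooth_continuous R _ _ (fun A : M3 => \det A)) => k.
by apply: Ck_det; [exact: openT|exact: Ck_id].
Qed.

Lemma open_unitmx : open [set A : M3 | A \in unitmx].
Proof.
rewrite (_ : mkset _ = (fun A : M3 => \det A) @^-1` [set x | x != 0]).
  by apply: open_comp; [move=> x _; exact: det_continuous|exact: open_neq].
by apply/seteqP; split=> A; rewrite /= unitmxE unitfE.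
Qed.

(** The second factor is applied to the symmetric part of U^T X, which is U^T
X itself on the normal bundle: in this form the map is smooth on all pairs of
matrices. *)
Definition tube (p : M3 * M3) : M3 :=
  p.1 *m cell_param (2^-1 *: (p.1^T *m p.2 + (p.1^T *m p.2)^T)).

Definition tube_inv (A : M3) : M3 * M3 :=
  (polar_rot A, polar_rot A *m cell_coord (polar_pos A)).

Lemma tubeE (U X : M3) : (U^T *m X)^T = U^T *m X -> tube (U, X) = U *m cell_param (U^T *m X).
Proof.
move=> sX; rewrite /tube /= sX; congr (_ *m cell_param _).
by move: (U^T *m X) => S; apply/matrixP => i j; rewrite !mxE; field.
Qed.

Lemma Ck_tube k : Ck_on k setT tube.
Proof.
have oT : open [set: M3 * M3] by exact: openT.
have C : Ck_on k setT (fun p : M3 * M3 => p.1^T *m p.2).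
  by apply: Ck_mulmx => //; [apply: Ck_trmx => //; exact: Ck_fst|exact: Ck_snd].
apply: Ck_mulmx => //; first exact: Ck_fst.
apply: Ck_cell_param => // [p _|]; first by rewrite trmxZ trmxD trmxK addrC.
apply: Ck_scale => //; first exact: Ck_cst.
by apply: CkD => //; exact: Ck_trmx.
Qed.

Lemma Ck_cell_coord_polar k : Ck_on k [set A : M3 | A \in unitmx] (fun A => cell_coord (polar_pos A)).
Proof.
apply: Ck_cell_coord; [exact: open_unitmx|by move=> A /polar_posP []|].
by apply: Ck_polar_pos; [exact: open_unitmx|by []|exact: Ck_id].
Qed.

Lemma Ck_rot k : Ck_on k [set A : M3 | A \in unitmx] (@polar_rot R).
Proof. by apply: Ck_polar_rot; [exact: open_unitmx|by []|exact: Ck_id]. Qed.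

Lemma Ck_tube_inv k : Ck_on k [set A : M3 | A \in unitmx] tube_inv.
Proof.
apply: Ck_pair; [exact: open_unitmx|exact: Ck_rot|].
by apply: Ck_mulmx; [exact: open_unitmx|exact: Ck_rot|exact: Ck_cell_coord_polar].
Qed.

Variable e : R.
Hypothesis ee : e * e = 1.

Definition det_side : set M3 := S8 `&` [set A | 0 < e * \det A].

Lemma det_side_unit A : det_side A -> A \in unitmx.
Proof.
move=> [_ /= dA]; rewrite unitmxE unitfE; apply/eqP => d0.
by rewrite d0 mulr0 ltxx in dA.
Qed.

Lemma mul_det_side (U P : M3) : orthogonal_det e U -> D5 P -> det_side (U *m P).
Proof.
move=> [OU dU] /D5P [pP nP]; split; first by apply/S8P; rewrite sqn_mul_orth.
by rewrite /= det_mulmx dU mulrA ee mul1r det_posdef.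
Qed.

Lemma polar_pos_D5 A : det_side A -> D5 (polar_pos A).
Proof.
move=> NA; have uA := det_side_unit NA; apply/D5P; split; first exact: (polar_posP uA).1.
by rewrite sqn_polar_pos //; exact/S8P/NA.1.
Qed.

Lemma polar_rot_orthogonal_det A : det_side A -> orthogonal_det e (polar_rot A).
Proof.
move=> NA; have uA := det_side_unit NA; have OA := polar_rot_orthogonal uA.
split=> //; have /D5P [/det_posdef dP _] := polar_pos_D5 NA.
have : 0 < e * \det (polar_rot A).
  have := NA.2; rewrite /= -{1}(polar_rotK uA) det_mulmx mulrA.
  by rewrite pmulr_lgt0.
have : e = 1 \/ e = -1.
  by move: ee; rewrite -expr2 => /eqP; rewrite sqrf_eq1 => /orP [] /eqP; auto.
by move=> [] ->; case: (det_orthogonal OA) => -> //; rewrite ?mulr1 ?mul1r ?mulN1r ?opprK ?ltrN10 // ltr0N1.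
Qed.

(** The sign of the determinant of A is that of its orthogonal factor. *)
Lemma bigcup_cell : \bigcup_(U in orthogonal_det e) cell U = det_side.
Proof.
apply/seteqP; split=> [A [U OU [P DP <-]]|A NA]; first exact: mul_det_side.
exists (polar_rot A); first exact: polar_rot_orthogonal_det.
exists (polar_pos A); first exact: polar_pos_D5.
exact/polar_rotK/det_side_unit.
Qed.

(** The orthogonal factor of a polar decomposition is unique. *)
Lemma trivIset_cell : trivIset (orthogonal_det e) (@cell R).
Proof.
move=> U U' [OU _] [OU' _] [A [[P /D5P [pP _] <-] [P' /D5P [pP' _] E]]].
by rewrite -(polar_rot_mul OU pP) -E polar_rot_mul.
Qed.

(** The inverse is the polar decomposition, which is continuous on the
invertible matrices. *)
Lemma polar_homeomorphism :
  homeomorphism (orthogonal_det e `*` D5) det_side (fun p : M3 * M3 => p.1 *m p.2).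
Proof.
pose g A := (polar_rot A, polar_pos A : M3).
have gK (p : M3 * M3) : (orthogonal_det e `*` D5) p -> g (p.1 *m p.2) = p.
  by case: p => U P [[OU _] /D5P [pP _]]; rewrite /g /= polar_rot_mul ?polar_pos_mul.
split.
- apply: (set_bij_inverse (g := g)) => //.
  + by move=> p [] *; exact: mul_det_side.
  + by move=> A NA; split; [exact: polar_rot_orthogonal_det|exact: polar_pos_D5].
  + by move=> A NA; exact/polar_rotK/det_side_unit.
- apply: continuous_within => p _; apply: Ck_smooth_continuous => k.
  by apply: Ck_mulmx; [exact: openT|exact: Ck_fst|exact: Ck_snd].
- exists g; split=> //; apply: continuous_within => A /det_side_unit uA.
  apply: (@Ck_continuous _ _ _ 1 [set A : M3 | A \in unitmx]) => //.
  apply: Ck_pair; [exact: open_unitmx|exact: Ck_rot|].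
  by apply: Ck_polar_pos; [exact: open_unitmx|by []|exact: Ck_id].
Qed.

Lemma rel_open_det_side : rel_open S8 det_side.
Proof.
exists [set A | 0 < e * \det A]; split=> //.
rewrite (_ : mkset _ = (fun A : M3 => e * \det A) @^-1` [set x | 0 < x]) //.
apply: open_comp; last exact: open_gt.
by move=> A _; apply: continuousM; [exact: cst_continuous|exact: det_continuous].
Qed.

Lemma tube_bundle p : normal_bundle S8 (orthogonal_det e) p ->
  [/\ orthogonal_det e p.1, (p.1^T *m p.2)^T = p.1^T *m p.2,
      \tr (p.1^T *m p.2) = 0 & tube p = p.1 *m cell_param (p.1^T *m p.2)].
Proof.
case: p => U X [/= OU /(normal_fiberP _ OU) [sX tX]]; split => //.
exact: tubeE.
Qed.

Lemma tube_inv_bundle A : det_side A ->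
  normal_bundle S8 (orthogonal_det e) (tube_inv A) /\
  (tube_inv A).1^T *m (tube_inv A).2 = cell_coord (polar_pos A).
Proof.
move=> NA; have OA := polar_rot_orthogonal_det NA.
have /D5P [pP _] := polar_pos_D5 NA.
have E : (polar_rot A)^T *m (polar_rot A *m cell_coord (polar_pos A)) = cell_coord (polar_pos A).
  by rewrite mulmxA (OA.1 : _ *m _ = _) mul1mx.
split=> //; split=> //=; apply/normal_fiberP => //.
by rewrite E cell_coord_sym // cell_coord_trace0.
Qed.

Lemma tubeK p : normal_bundle S8 (orthogonal_det e) p -> tube_inv (tube p) = p.
Proof.
move=> /tube_bundle [OU sX tX ->]; have /D5P [pP _] := cell_param_D5 sX.
rewrite /tube_inv polar_rot_mul ?polar_pos_mul //; try exact: OU.1.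
rewrite cell_paramK // mulmxA (mulmx1C (OU.1 : _ *m _ = _)) mul1mx.
by case: p {OU sX tX pP}.
Qed.

Lemma tube_invK A : det_side A -> tube (tube_inv A) = A.
Proof.
move=> NA; have [/tube_bundle [_ _ _ ->] ->] := tube_inv_bundle NA.
have /D5P [pP nP] := polar_pos_D5 NA.
by rewrite cell_coordK // polar_rotK // det_side_unit.
Qed.

Lemma tube_diffeomorphism :
  diffeomorphism (normal_bundle S8 (orthogonal_det e)) det_side tube.
Proof.
split.
- apply: (set_bij_inverse (g := tube_inv)).
  + by move=> p /tube_bundle [OU sX tX ->]; apply: mul_det_side => //; exact: cell_param_D5.
  + by move=> A /tube_inv_bundle [].
  + exact: tubeK.
  + exact: tube_invK.
- move=> p _; exists setT, tube; split=> //; first exact: openT.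
  exact: Ck_tube.
- exists tube_inv; split; last exact: tubeK.
  move=> A NA; exists [set A : M3 | A \in unitmx], tube_inv; split=> //.
  + exact: open_unitmx.
  + exact: det_side_unit.
  + exact: Ck_tube_inv.
Qed.

Lemma det_side_tubular :
  open_tubular_neighborhood S8 (orthogonal_det e) det_side (@cell R).
Proof.
split; first exact: rel_open_det_side.
exists tube; split; first exact: tube_diffeomorphism.
- by move=> U OU; rewrite tubeE mulmx0 ?trmx0 // cell_param0 mulmx1.
- move=> U OU; apply/seteqP; split=> A.
    move=> [X /(normal_fiberP _ OU) [sX tX] <-]; rewrite tubeE //.
    by exists (cell_param (U^T *m X)) => //; exact: cell_param_D5.
  move=> [P /D5P [pP nP] <-]; exists (U *m cell_coord P).
    apply/normal_fiberP => //; rewrite mulmxA (OU.1 : _ *m _ = _) mul1mx.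
    by rewrite cell_coord_sym // cell_coord_trace0.
  rewrite tubeE mulmxA (OU.1 : _ *m _ = _) mul1mx ?cell_coord_sym //.
  by rewrite cell_coordK.
- move=> U X OU /(normal_fiberP _ OU) [sX tX].
  have -> : (fun t : R => tube (U, t *: X)) = (fun t => U *m cell_param (t *: (U^T *m X))).
    by apply/funext => t; rewrite tubeE -!scalemxAr // trmxZ sX.
  have := is_derive_mulmx (is_derive_cst U (0 : R) (1 : R)) (is_derive_cell_param0 sX tX).
  move/is_derive_eq; apply.
  by rewrite mul0mx add0r mulmxA (mulmx1C (OU.1 : _ *m _ = _)) mul1mx.
Qed.

End Tube.

(** * The fibers as open 5-cells *)

Section Cells.
Variable R : realType.
Local Notation M3 := 'M[R]_3.

(** Rows of the symmetric matrix with diagonal r0, r1, - r0 - r1 and entries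
r2, r3, r4 above it. *)
Definition traceless_mx (r : 'rV[R]_5) : M3 :=
  \matrix_(i, j) nth 0 (nth [::]
    [:: [:: r 0 (inord 0); r 0 (inord 2); r 0 (inord 3)];
        [:: r 0 (inord 2); r 0 (inord 1); r 0 (inord 4)];
        [:: r 0 (inord 3); r 0 (inord 4);
            - 1 * (r 0 (inord 0) + r 0 (inord 1))]] i) j.

Definition traceless_coord (M : M3) : 'rV[R]_5 :=
  \row_k nth 0 [:: M 0 0; M 1 1; M 0 1; M 0 2; M 1 2] k.

Lemma ord3P (P : 'I_3 -> Prop) : P 0 -> P 1 -> P 2 -> forall i, P i.
Proof.
move=> P0 P1 P2 [[|[|[|//]]] h].
- by rewrite (_ : Ordinal h = 0) //; exact/val_inj.
- by rewrite (_ : Ordinal h = 1) //; exact/val_inj.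
- by rewrite (_ : Ordinal h = 2) //; exact/val_inj.
Qed.

Lemma traceless_mx_sym r : (traceless_mx r)^T = traceless_mx r.
Proof. by apply/matrixP; apply: ord3P; apply: ord3P; rewrite !mxE. Qed.

Lemma traceless_mx_trace r : \tr (traceless_mx r) = 0.
Proof. rewrite /mxtrace !big_ord_recl big_ord0 !mxE /=; ring. Qed.

Lemma traceless_mxK r : traceless_coord (traceless_mx r) = r.
Proof.
apply/rowP => k; rewrite mxE; case: k => [[|[|[|[|[|//]]]]] h]; rewrite /= mxE /=.
all: by congr (r _ _); apply/val_inj; rewrite /= inordK.
Qed.

Lemma traceless_coordK (M : M3) : M^T = M -> \tr M = 0 ->
  traceless_mx (traceless_coord M) = M.
Proof.
move=> MT tM.
have S i j : M i j = M j i by rewrite -{1}MT mxE.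
have D : M 2 2 = - 1 * (M 0 0 + M 1 1).
  have : \tr M = M 0 0 + M 1 1 + M 2 2.
    rewrite /mxtrace !big_ord_recl big_ord0 addr0 addrA.
    by congr (M _ _ + M _ _ + M _ _); exact/val_inj.
  by rewrite tM => h; lra.
apply/matrixP; apply: ord3P; apply: ord3P; rewrite mxE /= !mxE !inordK //=.
Qed.

Lemma Ck_traceless_mx k : Ck_on k setT traceless_mx.
Proof.
have oT : open [set: 'rV[R]_5] by exact: openT.
have C l : Ck_on k setT (fun r : 'rV[R]_5 => r 0 (inord l)).
  by move: (Ck_id k [set: 'rV[R]_5]) => /(Ck_mxP _ _ oT); apply.
apply/Ck_mxP => // i j.
suff : Ck_on k setT (fun r : 'rV[R]_5 =>
    nth 0 (nth [::]
      [:: [:: r 0 (inord 0); r 0 (inord 2); r 0 (inord 3)];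
          [:: r 0 (inord 2); r 0 (inord 1); r 0 (inord 4)];
          [:: r 0 (inord 3); r 0 (inord 4);
              - 1 * (r 0 (inord 0) + r 0 (inord 1))]] i) j).
  by apply: Ck_ext => // r _; rewrite mxE.
move: i j; apply: ord3P; apply: ord3P; rewrite /=; try exact: C.
by apply: CkM => //; [exact: Ck_cst|exact: CkD].
Qed.

Lemma Ck_traceless_coord k : Ck_on k setT traceless_coord.
Proof.
have oT : open [set: M3] by exact: openT.
have C a b : Ck_on k setT (fun M : M3 => M a b).
  by move: (Ck_id k [set: M3]) => /(Ck_mxP _ _ oT); apply.
apply/Ck_mxP => // i j.
suff : Ck_on k setT (fun M : M3 => nth 0 [:: M 0 0; M 1 1; M 0 1; M 0 2; M 1 2] j).
  by apply: Ck_ext => // r _; rewrite mxE.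
by case: j => [[|[|[|[|[|//]]]]] h]; rewrite /=.
Qed.

(** A point A = U P of the cell has P = sqrt (A^T A), so the inverse of the
parametrization by U [cell_param S] can be written without U. *)
Lemma open_cell_cell (U : M3) : O3 U -> open_cell R 5 (cell U).
Proof.
move=> OU.
pose f (r : 'rV[R]_5) := U *m cell_param (traceless_mx r).
pose g (A : M3) := traceless_coord (cell_coord (polar_pos A)).
have gK r : g (f r) = r.
  have sr := traceless_mx_sym r; have /D5P [pP _] := cell_param_D5 sr.
  by rewrite /g polar_pos_mul // cell_paramK ?traceless_mx_trace // traceless_mxK.
exists f; split.
- apply: (set_bij_inverse (g := g)) => //.
    by move=> r _; exists (cell_param (traceless_mx r)) => //; exact/cell_param_D5/traceless_mx_sym.
  move=> A [P /D5P [pP nP] <-]; rewrite /f /g polar_pos_mul //.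
  by rewrite traceless_coordK ?cell_coord_sym ?cell_coord_trace0 // cell_coordK.
- apply: continuous_within => r _; apply: Ck_smooth_continuous => k.
  apply: Ck_mulmx; [exact: openT|exact: Ck_cst|].
  apply: Ck_cell_param; [exact: openT|by move=> x _; exact: traceless_mx_sym|].
  exact: Ck_traceless_mx.
- exists g; split=> //; apply: continuous_within => A [P /D5P [pP _] <-].
  have uA : U *m P \in unitmx by rewrite unitmx_mul orthogonal_unit // posdef_unit.
  apply: (@continuous_comp _ _ _ (fun A : M3 => cell_coord (polar_pos A)) traceless_coord).
    exact: (Ck_continuous (@Ck_cell_coord_polar R 1)).
  exact: Ck_smooth_continuous Ck_traceless_coord.
Qed.

End Cells.

(** * The common boundary *)

Section Boundary.
Variable R : realType.
Local Notation M3 := 'M[R]_3.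

Lemma mul1_neq0 (e : R) : e * e = 1 -> e != 0.
Proof. by move=> /eqP; apply: contraTneq => ->; rewrite mul0r eq_sym oner_eq0. Qed.

(** The matrix A + t is singular only if - t is a root of the characteristic
polynomial, which has degree 3; among the four shifts d / 1, d / 2, d / 3, d /
4 one is nonsingular. *)
Lemma small_shift_nonsingular (A : M3) (d : R) : 0 < d ->
  exists t : R, [/\ 0 < t, t <= d & \det (A + t%:M) != 0].
Proof.
move=> d0.
(* Four distinct candidates for a root, one more than the degree. *)
pose s (i : 'I_4) : R := - (d / (i.+1)%:R).
have s_inj : injective s.
  move=> i j /oppr_inj /(mulfI (lt0r_neq0 d0)) /invr_inj /eqP.
  by rewrite eqr_nat eqSS => /eqP /val_inj.
have p0 : char_poly A != 0 by rewrite monic_neq0 // char_poly_monic.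
have : ~~ all (root (char_poly A)) [seq s i | i <- enum 'I_4].
  apply/negP => al; have := max_poly_roots p0 al.
  rewrite map_inj_uniq ?enum_uniq // size_char_poly size_map size_enum_ord ltnn.
  by move=> /(_ isT).
rewrite -has_predC => /hasP [_ /mapP [i _ ->]] /= nr.
exists (d / i.+1%:R); split.
- by rewrite divr_gt0.
- by rewrite ler_pdivrMr // ler_peMr ?ler1n // ltW.
- apply: contra nr => /det0P [v v0 vA]; rewrite -eigenvalue_root_char.
  apply/eigenvalueP; exists v => //.
  apply/eqP; rewrite -subr_eq0 /s scaleNr opprK -mul_mx_scalar -mulmxDr vA //.
Qed.

(** The reflection H = 1 - 2 u^T u along a unit row vector [u] with u A = 0. *)
Lemma singular_reflection (A : M3) : \det A = 0 ->
  exists H : M3, H *m A = A /\ \det H = -1.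
Proof.
move=> /eqP /det0P [v v0 vA].
have nv := sqn_gt0 v0.
pose u := (Num.sqrt (sqn v))^-1 *: v.
have u1 : sqn u = 1 by rewrite sqnZ exprVn sqr_sqrtr ?(ltW nv) // mulVf // gt_eqF.
have uA : u *m A = 0 by rewrite -scalemxAl vA scaler0.
have [Q [QQ Qu]] := orthogonal_with_first_row u1.
have QQ' : Q^T *m Q = 1%:M by exact: mulmx1C.
pose d : 'rV[R]_3 := \row_i (-1) ^+ (i == 0).
exists (Q^T *m diag_mx d *m Q); split.
  suff E : diag_mx d *m (Q *m A) = Q *m A.
    by rewrite -!mulmxA E mulmxA QQ' mul1mx.
  have r0 : row 0 (Q *m A) = 0 by rewrite rowE mulmxA Qu uA.
  move: (Q *m A) r0 => B r0; apply/matrixP => i j; rewrite mul_diag_mx !mxE.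
  have [->|i0] := eqVneq i 0; last by rewrite expr0 mul1r.
  by have := congr1 (fun r : 'rV_3 => r 0 j) r0; rewrite !mxE => ->; rewrite mulr0.
rewrite !det_mulmx mulrC mulrA -det_mulmx QQ det1 mul1r det_diag.
rewrite (bigD1 0) //= mxE eqxx expr1 big1 ?mulr1 // => i i0.
by rewrite mxE (negPf i0).
Qed.

(** The matrices A + t and H (A + t), with H from [singular_reflection], tend
to A and H A = A as t tends to 0, and their determinants are opposite. *)
Lemma approach_singular (e : R) (A : M3) (W : set M3) : e * e = 1 ->
  \det A = 0 -> nbhs A W -> exists B, W B /\ 0 < e * \det B.
Proof.
move=> ee dA nW; have [H [HA dH]] := singular_reflection dA.
have e0 := mul1_neq0 ee.
have near0 (F : R -> M3) : (forall k, Ck_on k setT F) -> F 0 = A ->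
    \forall t \near (0 : R), W (F t).
  by move=> CF F0; apply: (Ck_smooth_continuous (x := 0) CF); rewrite F0.
have CS k : Ck_on k setT (fun t : R => A + t%:M).
  apply: CkD; [exact: openT|exact: Ck_cst|].
  have C : Ck_on k setT (fun t : R => t *: 1%:M : M3).
    by apply: Ck_scale; [exact: openT|exact: Ck_id|exact: Ck_cst].
  by apply: Ck_ext C; [exact: openT|move=> t _; rewrite scalemx1].
have n1 := near0 _ CS; have n2 := near0 (fun t => H *m (A + t%:M)).
have : \forall t \near (0 : R), W (A + t%:M) /\ W (H *m (A + t%:M)).
  near=> t; split; near: t.
    by apply: n1; rewrite raddf0 addr0.
  apply: n2; last by rewrite raddf0 addr0 HA.
  by move=> k; apply: Ck_mulmx; [exact: openT|exact: Ck_cst|exact: CS].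
move=> /nbhs_ballP [d /= d0 dW].
have [t [t0 td dt]] := small_shift_nonsingular A (divr_gt0 d0 (ltr0Sn R 1)).
have [W1 W2] : W (A + t%:M) /\ W (H *m (A + t%:M)).
  apply: dW; rewrite /ball /= sub0r normrN gtr0_norm //.
  by apply: le_lt_trans td _; rewrite ltr_pdivrMr // ltr_pMr // ltr1n.
have [ed|ed] : 0 < e * \det (A + t%:M) \/ e * \det (A + t%:M) < 0.
    have : e * \det (A + t%:M) != 0 by rewrite mulf_neq0.
    by rewrite neq_lt => /orP [] ?; auto.
  by exists (A + t%:M).
exists (H *m (A + t%:M)); split=> //.
by rewrite det_mulmx dH mulN1r mulrN oppr_gt0.
Unshelve. all: by end_near. Qed.

Definition normalize (A : M3) : M3 := (Num.sqrt 3 / Num.sqrt (sqn A)) *: A.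

Lemma normalize_S8 (A : M3) : A != 0 -> S8 (normalize A).
Proof.
move=> /sqn_gt0 nA; apply/S8P.
by rewrite sqnZ exprMn exprVn !sqr_sqrtr ?(ltW nA) // mulfVK // gt_eqF.
Qed.

Lemma normalize_id (A : M3) : S8 A -> normalize A = A.
Proof. by move=> /S8P nA; rewrite /normalize nA divff ?scale1r // gt_eqF // sqrtr_gt0. Qed.

Lemma normalize_continuous (A : M3) : A != 0 -> {for A, continuous normalize}.
Proof.
move=> A0.
have oU : open [set B : M3 | 0 < sqn B].
  rewrite (_ : mkset _ = (fun B : M3 => sqn B) @^-1` [set x | 0 < x]) //.
  apply: open_comp; last exact: open_gt.
  move=> B _; apply: Ck_smooth_continuous => k.
  by apply: Ck_sqn; [exact: openT|exact: Ck_id].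
apply: (@Ck_continuous _ _ _ 1 [set B : M3 | 0 < sqn B]); last exact: sqn_gt0.
apply: Ck_scale; [exact: oU| |exact: Ck_id].
apply: CkM; [exact: oU|exact: Ck_cst|].
apply: CkV; first exact: oU.
  by move=> B B0; rewrite gt_eqF // sqrtr_gt0.
apply: Ck_sqrt; [exact: oU|by []|].
by apply: Ck_sqn; [exact: oU|exact: Ck_id].
Qed.

Lemma S8_neq0 (A : M3) : S8 A -> A != 0.
Proof.
move=> /S8P nA; apply/eqP => A0; move: nA; rewrite A0 sqn0 => /eqP.
by rewrite eq_sym pnatr_eq0.
Qed.

(** A limit of points where e * det A > 0 and of points where e * det A <= 0
is singular by continuity. Conversely, radial projection to the sphere moves
the points given by [approach_singular] onto it. *)
Lemma rel_boundary_det_side (e : R) : e * e = 1 ->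
  rel_boundary S8 (det_side e) = V7.
Proof.
move=> ee.
have e0 := mul1_neq0 ee.
have cd : continuous (fun A : M3 => e * \det A).
  by move=> A; apply: continuousM; [exact: cst_continuous|exact: det_continuous].
have closed_ge_side : closed [set A : M3 | 0 <= e * \det A].
  rewrite (_ : mkset _ = (fun A : M3 => e * \det A) @^-1` [set x | 0 <= x]) //.
  by apply: closed_comp; [move=> A _; exact: cd|exact: closed_ge].
have closed_le_side : closed [set A : M3 | e * \det A <= 0].
  rewrite (_ : mkset _ = (fun A : M3 => e * \det A) @^-1` [set x | x <= 0]) //.
  by apply: closed_comp; [move=> A _; exact: cd|exact: closed_le].
apply/seteqP; split=> A.
  move=> [[SA cN] cD]; split=> //.
  have g0 : [set A : M3 | 0 <= e * \det A] A.
    rewrite ((closure_id _).1 closed_ge_side); apply: closureS cN.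
    by move=> B [_ /ltW].
  have l0 : [set A : M3 | e * \det A <= 0] A.
    rewrite ((closure_id _).1 closed_le_side); apply: closureS cD.
    by move=> B [SB nB] /=; rewrite leNgt; apply/negP => ?; exact: nB.
  have : e * \det A == 0 by rewrite eq_le; apply/andP.
  by rewrite mulf_eq0 (negPf e0) => /eqP.
move=> [SA dA]; split; [split=> //|].
  move=> W; rewrite -{1}(normalize_id SA) => nW.
  have [B [WB dB]] := approach_singular ee dA (normalize_continuous (S8_neq0 SA) nW).
  have B0 : B != 0 by apply/eqP => B0; move: dB; rewrite B0 det0 mulr0 ltxx.
  exists (normalize B); split=> //; split; first exact: normalize_S8.
  rewrite /= /normalize detZ mulrCA mulr_gt0 // exprn_gt0 // divr_gt0 ?sqrtr_gt0 //.
  exact: sqn_gt0.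
apply: subset_closure; split=> // -[_] /=.
by rewrite dA mulr0 ltxx.
Qed.

End Boundary.

Theorem mainTheorem1 (R : realType) :
  let N : set 'M[R]_3 := \bigcup_(U in SO3) cell U in
  let N' : set 'M[R]_3 := \bigcup_(U in Ominus3) cell U in
  [/\ (forall U : 'M[R]_3, SO3 U -> open_cell R 5 (cell U)),
      trivIset SO3 (@cell R),
      open_tubular_neighborhood S8 SO3 N (@cell R) &
      homeomorphism (SO3 `*` D5) N
        (fun p : 'M[R]_3 * 'M[R]_3 => p.1 *m p.2)] /\
  [/\ (forall U : 'M[R]_3, Ominus3 U -> open_cell R 5 (cell U)),
      trivIset Ominus3 (@cell R),
      open_tubular_neighborhood S8 Ominus3 N' (@cell R) &
      homeomorphism (Ominus3 `*` D5) N'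
        (fun p : 'M[R]_3 * 'M[R]_3 => p.1 *m p.2)] /\
  (rel_boundary S8 N = V7 /\ rel_boundary S8 N' = V7).
Proof.
have e1 : (1 : R) * 1 = 1 by rewrite mulr1.
have e2 : (-1 : R) * -1 = 1 by rewrite mulrNN mulr1.
rewrite /= -[SO3]/(orthogonal_det 1) -[Ominus3]/(orthogonal_det (-1)) !bigcup_cell //.
split; [|split].
- split.
  + by move=> U [OU _]; exact: open_cell_cell.
  + exact: trivIset_cell.
  + exact: det_side_tubular.
  + exact: polar_homeomorphism.
- split.
  + by move=> U [OU _]; exact: open_cell_cell.
  + exact: trivIset_cell.
  + exact: det_side_tubular.
  + exact: polar_homeomorphism.
- by split; exact: rel_boundary_det_side.
Qed.
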